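(* There exist absolute constants $\Psi_1,\Psi_2,\Psi_3>0$ and $\tilde C>0$ such that the following holds. Let $P_*\in\mathcal N(n,K_*,L_* )$, with parameters satisfying Assumptions A1 and A2, and let $A$ be generated from $P_*$ as in the network model. Put $$\overline{\mathrm{Pen}}(K,L)=\Psi_1nK+\Psi_2K^2\ln n+\Psi_3 n\ln K .$$ Let $(\hat z,\hat c,\hat K,\hat L)$ minimize $$\sum_{l=1}^{L}\sum_{k=1}^{K}\big\|A^{(l,k)}(z,c)-\Pi_{(1)}\big(A^{(l,k)}(z,c)\big)\big\|_F^2+\overline{\mathrm{Pen}}(K,L)$$ over $1\le L\le K\le n$, $z:\{1,\dots,n\}\to\{1,\dots,K\}$ and $c:\{1,\dots,K\}\to\{1,\dots,L\}$. Define $\hat P\in\mathbb R^{n\times n}$ by requiring that, for every $l\le\hat L$ and $k\le\hat K$, its submatrix with rows $J_l(\hat z,\hat c)$ and columns $I_k(\hat z)$ equals $\Pi_{(1)}\big(A^{(l,k)}(\hat z,\hat c)\big)$. Then for every $t>0$ $$\mathbb P\Big\{\|\hat P-P_*\|_F^2\le\tilde C\big[\overline{\mathrm{Pen}}(K_*,L_* )+t\big]\Big\}\ge 1-3e^{-t},$$ and $$\mathbb E\|\hat P-P_*\|_F^2\le\tilde C\big[\overline{\mathrm{Pen}}(K_*,L_* )+3\big].$$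
   Context: Network model: $n\ge 2$ nodes; $P_*\in[0,1]^{n\times n}$ is symmetric; $A\in\{0,1\}^{n\times n}$ is symmetric with entries $A_{ij}$, $1\le i\le j\le n$, independent, $A_{ij}\sim\mathrm{Bernoulli}((P_* )_{ij})$, and $A_{ji}=A_{ij}$. Nested Block Model class: for integers $1\le L\le K\le n$, $\mathcal N(n,K,L)$ is the set of matrices $P\in[0,1]^{n\times n}$ for which there exist a clustering function $z:\{1,\dots,n\}\to\{1,\dots,K\}$ (communities), a clustering function $c:\{1,\dots,K\}\to\{1,\dots,L\}$ (meta-communities), a matrix $B\in[0,1]^{K\times K}$ and a matrix $H\in\mathbb R_+^{n\times L}$ such that, with $n_k=\#\{i:z(i)=k\}$, $$\sum_{i:\,z(i)=k}H_{i,l}=n_k\quad\text{for all }k\le K,\ l\le L,$$ and $$P_{ij}=B_{z(i),z(j)}\,H_{i,c(z(j))}\,H_{j,c(z(i))}\quad\text{for all }i,j.$$ For such a representation, $h^{(k,l)}\in\mathbb R_+^{n_k}$ denotes the subvector $(H_{i,l})_{i:\,z(i)=k}$. Assumptions on the true matrix $P_*\in\mathcal N(n,K_*,L_* )$ with representation $(z_*,c_*,B,H)$: - A1: $B$ is nonsingular with smallest singular value at least $\lambda_0>0$. - A2: for each $k=1,\dots,K_*$, the vectors $h^{(k,l)}$, $l=1,\dots,L_*$, are linearly independent. Blocks: for $z:\{1,\dots,n\}\to\{1,\dots,K\}$ and $c:\{1,\dots,K\}\to\{1,\dots,L\}$, set $$I_k(z)=\{i:z(i)=k\},\qquad J_l(z,c)=\{j:c(z(j))=l\}.$$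 For a matrix $M\in\mathbb R^{n\times n}$, $M^{(l,k)}(z,c)$ is the submatrix of $M$ with rows indexed by $J_l(z,c)$ and columns indexed by $I_k(z)$. For any real matrix $M$, $\Pi_{(1)}(M)=\sigma_1u_1v_1^T$ is its best rank-one approximation (in Frobenius norm), where $\sigma_1$ is the largest singular value of $M$ and $u_1,v_1$ are corresponding unit singular vectors. *)

(* Defs.v *)
(* real numbers (ln, exp) from Stdlib Reals.
   Indices are 0-based: node i ranges over 0..n-1, community k over 0..K-1,
   meta-community l over 0..L-1.  Matrices are functions nat -> nat -> R,
   only their entries with indices in range matter. *)
From Stdlib Require Import Reals List Arith.
Open Scope R_scope.

Fixpoint fsum (m : nat) (f : nat -> R) : R :=
  match m with
  | O => 0
  | S m' => fsum m' f + f m'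
  end.

Definition frob2 (n : nat) (M N : nat -> nat -> R) : R :=
  fsum n (fun i => fsum n (fun j => (M i j - N i j) ^ 2)).

Definition nk (n : nat) (z : nat -> nat) (k : nat) : R :=
  fsum n (fun i => if Nat.eqb (z i) k then 1 else 0).

Definition NBM_rep (n K L : nat) (P : nat -> nat -> R)
  (z c : nat -> nat) (B H : nat -> nat -> R) : Prop :=
  (1 <= L)%nat /\ (L <= K)%nat /\ (K <= n)%nat /\
  (forall i j, (i < n)%nat -> (j < n)%nat -> 0 <= P i j <= 1) /\
  (forall i, (i < n)%nat -> (z i < K)%nat) /\
  (forall k, (k < K)%nat -> (c k < L)%nat) /\
  (forall k k', (k < K)%nat -> (k' < K)%nat -> 0 <= B k k' <= 1) /\
  (forall i l, (i < n)%nat -> (l < L)%nat -> 0 <= H i l) /\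
  (forall k l, (k < K)%nat -> (l < L)%nat ->
     fsum n (fun i => if Nat.eqb (z i) k then H i l else 0) = nk n z k) /\
  (forall i j, (i < n)%nat -> (j < n)%nat ->
     P i j = B (z i) (z j) * H i (c (z j)) * H j (c (z i))).

(* Assumption A1: B (K x K) has smallest singular value at least lam0,
   i.e. ||B x||_2^2 >= lam0^2 ||x||_2^2 for all x in R^K
   (variational characterisation of sigma_min; with lam0 > 0 this also
   gives nonsingularity). *)
Definition AssumptionA1 (K : nat) (B : nat -> nat -> R) (lam0 : R) : Prop :=
  0 < lam0 /\
  forall x : nat -> R,
    fsum K (fun k => (fsum K (fun k' => B k k' * x k')) ^ 2)
    >= lam0 ^ 2 * fsum K (fun k => x k ^ 2).

Definition AssumptionA2 (n K L : nat) (z : nat -> nat) (H : nat -> nat -> R) : Prop :=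
  forall k, (k < K)%nat ->
    forall a : nat -> R,
      (forall i, (i < n)%nat -> z i = k -> fsum L (fun l => a l * H i l) = 0) ->
      forall l, (l < L)%nat -> a l = 0.

Definition Graph := nat -> nat -> bool.
Definition adj (a : Graph) : nat -> nat -> R :=
  fun i j => if a i j then 1 else 0.

Definition upd (a : Graph) (i j : nat) (b : bool) : Graph :=
  fun x y => if ((Nat.eqb x i && Nat.eqb y j) || (Nat.eqb x j && Nat.eqb y i))%bool
             then b else a x y.

Definition empty_graph : Graph := fun _ _ => false.

Definition upper_pairs (n : nat) : list (nat * nat) :=
  flat_map (fun j => map (fun i => (i, j)) (seq 0 (S j))) (seq 0 n).

(* expectation over independent A_ij ~ Bernoulli(p i j), i <= j, A_ji = A_ij *)
Fixpoint expect_aux (p : nat -> nat -> R) (ps : list (nat * nat))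
  (a : Graph) (F : Graph -> R) : R :=
  match ps with
  | nil => F a
  | (i, j) :: ps' =>
      p i j * expect_aux p ps' (upd a i j true) F
      + (1 - p i j) * expect_aux p ps' (upd a i j false) F
  end.

Definition Expect (n : nat) (p : nat -> nat -> R) (F : Graph -> R) : R :=
  expect_aux p (upper_pairs n) empty_graph F.

Definition Prob_le (n : nat) (p : nat -> nat -> R) (X : Graph -> R) (c : R) : R :=
  Expect n p (fun a => if Rle_dec (X a) c then 1 else 0).

Definition Jrow (z c : nat -> nat) (l : nat) : nat -> bool :=
  fun i => Nat.eqb (c (z i)) l.
Definition Icol (z : nat -> nat) (k : nat) : nat -> bool :=
  fun j => Nat.eqb (z j) k.

Definition blockdist (n : nat) (M X : nat -> nat -> R) (Rs Cs : nat -> bool) : R :=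
  fsum n (fun i => if Rs i then
     fsum n (fun j => if Cs j then (M i j - X i j) ^ 2 else 0) else 0).

Definition rank_le1_on (n : nat) (Rs Cs : nat -> bool) (X : nat -> nat -> R) : Prop :=
  exists u v : nat -> R,
    forall i j, (i < n)%nat -> (j < n)%nat -> Rs i = true -> Cs j = true ->
      X i j = u i * v j.

Definition best_rank1 (n : nat) (M : nat -> nat -> R) (Rs Cs : nat -> bool)
  (X : nat -> nat -> R) : Prop :=
  rank_le1_on n Rs Cs X /\
  forall Y, rank_le1_on n Rs Cs Y -> blockdist n M X Rs Cs <= blockdist n M Y Rs Cs.

Definition Pen (Psi1 Psi2 Psi3 : R) (n K L : nat) : R :=
  Psi1 * INR n * INR K + Psi2 * INR K ^ 2 * ln (INR n) + Psi3 * INR n * ln (INR K).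

Definition valid (n K L : nat) (z c : nat -> nat) : Prop :=
  (1 <= L)%nat /\ (L <= K)%nat /\ (K <= n)%nat /\
  (forall i, (i < n)%nat -> (z i < K)%nat) /\
  (forall k, (k < K)%nat -> (c k < L)%nat).

Definition crit (n : nat) (pen : nat -> nat -> R) (M : nat -> nat -> R)
  (K L : nat) (z c : nat -> nat) (X : nat -> nat -> nat -> nat -> R) : R :=
  fsum L (fun l => fsum K (fun k => blockdist n M (X l k) (Jrow z c l) (Icol z k)))
  + pen K L.

Definition rank1_family (n K L : nat) (M : nat -> nat -> R) (z c : nat -> nat)
  (X : nat -> nat -> nat -> nat -> R) : Prop :=
  forall l k, (l < L)%nat -> (k < K)%nat -> best_rank1 n M (Jrow z c l) (Icol z k) (X l k).

Definition is_estimate (n : nat) (pen : nat -> nat -> R) (M : nat -> nat -> R)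
  (Phat : nat -> nat -> R) : Prop :=
  exists (Kh Lh : nat) (zh ch : nat -> nat) (X : nat -> nat -> nat -> nat -> R),
    valid n Kh Lh zh ch /\
    rank1_family n Kh Lh M zh ch X /\
    (forall i j, (i < n)%nat -> (j < n)%nat -> Phat i j = X (ch (zh i)) (zh j) i j) /\
    (forall K L z c X', valid n K L z c -> rank1_family n K L M z c X' ->
       crit n pen M Kh Lh zh ch X <= crit n pen M K L z c X').

(* Main.v *)
(* Write [Xi = A - Ps] and [r = c o z]; a blockwise rank-one matrix is then
   [Q i j = U i (z j) * V j (r i)] with [n x K] matrices [U], [V].  Minimality of the
   criterion against [Ps] itself gives
     |Phat - Ps|^2 <= 2 <Xi, Phat - Ps> + Pen (Ks, Ls) - Pen (Khat, Lhat),
   so the noise term has to be dominated by [|Phat - Ps|^2 / 2], a multiple of the penalty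
   and a random remainder.  For a fixed matrix [D], [E exp (<Xi, D> - 4 |D|^2) <= 1]; summing
   over a prefix code of matrices [D] with lengths [q D] gives a random variable [W] with
   [E W <= 3] and [<Xi, D> <= 4 |D|^2 + q D + ln W] for all coded [D] at once.  Both conclusions
   follow, by Markov's inequality and by [ln W <= W].

   Two families are coded: multiples of [P' - Ps], where [P'] is the best approximation of [Ps]
   with the block structure given by [z] and [r], and blockwise rank-one matrices with integer factors, an
   integer [a] having length [a^2 + 2].  Real factors reduce to integer ones without any net:
   with one factor fixed, [<Xi, D> - 4 |D|^2 - cost] is a separable quadratic in the other, and
   rounding a coordinate loses at most a quarter of the leading coefficient.  With
   [U] scaled so that its restriction to a block has squared norm equal to the number of rows,
   the total loss is of order [n K].  Finally [Phat - P'] splits in every block into two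
   orthogonal rank-one matrices. *)
Require Import Defs.
From Stdlib Require Import Reals ZArith List Arith Lra Lia Classical IndefiniteDescription.
Import ListNotations.
Open Scope R_scope.

Lemma fsum_ext (m : nat) (f g : nat -> R) :
  (forall i, (i < m)%nat -> f i = g i) -> fsum m f = fsum m g.
Proof.
  induction m as [|m IH]; simpl; intros E; [reflexivity|].
  rewrite IH, E by auto with arith; reflexivity.
Qed.

Lemma fsum_le (m : nat) (f g : nat -> R) :
  (forall i, (i < m)%nat -> f i <= g i) -> fsum m f <= fsum m g.
Proof.
  induction m as [|m IH]; simpl; intros E; [lra|].
  assert (fsum m f <= fsum m g) by auto with arith.
  assert (f m <= g m) by auto with arith; lra.
Qed.

Lemma fsum_plus (m : nat) (f g : nat -> R) :
  fsum m (fun i => f i + g i) = fsum m f + fsum m g.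
Proof. induction m as [|m IH]; simpl; [lra|]; rewrite IH; lra. Qed.

Lemma fsum_scal (m : nat) (x : R) (f : nat -> R) :
  fsum m (fun i => x * f i) = x * fsum m f.
Proof. induction m as [|m IH]; simpl; [lra|]; rewrite IH; lra. Qed.

Lemma fsum_const (m : nat) (x : R) : fsum m (fun _ => x) = INR m * x.
Proof. induction m as [|m IH]; simpl fsum; [simpl; lra|]; rewrite IH, S_INR; lra. Qed.

Lemma fsum_nonneg (m : nat) (f : nat -> R) :
  (forall i, (i < m)%nat -> 0 <= f i) -> 0 <= fsum m f.
Proof.
  intros F; replace 0 with (fsum m (fun _ => 0)) by (rewrite fsum_const; ring).
  now apply fsum_le.
Qed.

Lemma fsum_zero (m : nat) (f : nat -> R) :
  (forall i, (i < m)%nat -> f i = 0) -> fsum m f = 0.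
Proof. intros F; rewrite (fsum_ext m f (fun _ => 0)) by exact F; rewrite fsum_const; ring. Qed.

Lemma fsum_term_le (m : nat) (f : nat -> R) (i : nat) :
  (forall j, (j < m)%nat -> 0 <= f j) -> (i < m)%nat -> f i <= fsum m f.
Proof.
  induction m as [|m IH]; intros F Hi; [lia|]; simpl.
  assert (0 <= f m) by (apply F; lia).
  assert (0 <= fsum m f) by (apply fsum_nonneg; auto with arith).
  destruct (Nat.eq_dec i m) as [->|Hn]; [lra|].
  assert (f i <= fsum m f) by (apply IH; [auto with arith | lia]); lra.
Qed.

Lemma fsum_abs_le (m : nat) (f : nat -> R) (b : R) :
  (forall i, (i < m)%nat -> Rabs (f i) <= b) -> Rabs (fsum m f) <= INR m * b.
Proof.
  induction m as [|m IH]; simpl fsum; intros F.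
  - rewrite Rabs_R0; simpl; lra.
  - rewrite S_INR. apply Rle_trans with (1 := Rabs_triang _ _).
    assert (Rabs (f m) <= b) by auto with arith.
    assert (Rabs (fsum m f) <= INR m * b) by auto with arith; lra.
Qed.

Lemma fsum_swap (m p : nat) (f : nat -> nat -> R) :
  fsum m (fun i => fsum p (fun j => f i j)) = fsum p (fun j => fsum m (fun i => f i j)).
Proof.
  induction m as [|m IH]; simpl.
  - now rewrite fsum_zero.
  - rewrite IH, <- fsum_plus; reflexivity.
Qed.

Lemma fsum_pick (m k : nat) (f : nat -> R) :
  (k < m)%nat -> fsum m (fun l => if Nat.eqb k l then f l else 0) = f k.
Proof.
  induction m as [|m IH]; intros Hk; [lia|]; simpl.
  destruct (Nat.eqb_spec k m) as [->|Hn].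
  - rewrite fsum_zero; [lra|].
    intros i Hi; destruct (Nat.eqb_spec m i); [lia|reflexivity].
  - rewrite IH by lia; lra.
Qed.

Lemma fsum_if_pick (m K : nat) (r : nat -> nat) (f : nat -> nat -> R) :
  (forall i, (i < m)%nat -> (r i < K)%nat) ->
  fsum m (fun i => f i (r i)) =
  fsum K (fun l => fsum m (fun i => if Nat.eqb (r i) l then f i l else 0)).
Proof.
  intros Hr; rewrite fsum_swap; apply fsum_ext; intros i Hi.
  symmetry; apply (fsum_pick K (r i) (f i)); auto.
Qed.

Definition sum2 (n m : nat) (f : nat -> nat -> R) : R :=
  fsum n (fun i => fsum m (fun j => f i j)).

Lemma sum2_ext n m f g :
  (forall i j, (i < n)%nat -> (j < m)%nat -> f i j = g i j) -> sum2 n m f = sum2 n m g.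
Proof. intros E; apply fsum_ext; intros; apply fsum_ext; auto. Qed.

Lemma sum2_le n m f g :
  (forall i j, (i < n)%nat -> (j < m)%nat -> f i j <= g i j) -> sum2 n m f <= sum2 n m g.
Proof. intros E; apply fsum_le; intros; apply fsum_le; auto. Qed.

Lemma sum2_plus n m f g :
  sum2 n m (fun i j => f i j + g i j) = sum2 n m f + sum2 n m g.
Proof.
  unfold sum2; rewrite <- fsum_plus; apply fsum_ext; intros; apply fsum_plus.
Qed.

Lemma sum2_scal n m x f : sum2 n m (fun i j => x * f i j) = x * sum2 n m f.
Proof.
  unfold sum2; rewrite <- fsum_scal; apply fsum_ext; intros; apply fsum_scal.
Qed.

Lemma sum2_const n m x : sum2 n m (fun _ _ => x) = INR n * INR m * x.
Proof.
  unfold sum2; rewrite (fsum_ext n _ (fun _ => INR m * x)); [|intros; apply fsum_const].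
  rewrite fsum_const; ring.
Qed.

Lemma sum2_nonneg n m f :
  (forall i j, (i < n)%nat -> (j < m)%nat -> 0 <= f i j) -> 0 <= sum2 n m f.
Proof. intros F; apply fsum_nonneg; intros; apply fsum_nonneg; auto. Qed.

Lemma sum2_swap n m f : sum2 n m f = sum2 m n (fun j i => f i j).
Proof. apply fsum_swap. Qed.

Lemma sum2_if_pick n K r (f : nat -> nat -> nat -> R) :
  (forall i, (i < n)%nat -> (r i < K)%nat) ->
  sum2 n n (fun i j => f i j (r i)) =
  sum2 n K (fun j l => fsum n (fun i => if Nat.eqb (r i) l then f i j l else 0)).
Proof.
  intros Hr; rewrite sum2_swap; apply fsum_ext; intros j Hj.
  apply (fsum_if_pick n K r (fun i l => f i j l) Hr).
Qed.

Definition Lsum {X : Type} (l : list X) (f : X -> R) : R :=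
  fold_right (fun x s => f x + s) 0 l.

Lemma Lsum_app {X} (l l' : list X) f : Lsum (l ++ l') f = Lsum l f + Lsum l' f.
Proof. induction l as [|x l IH]; simpl; [lra|]; rewrite IH; lra. Qed.

Lemma Lsum_map {X Y} (h : X -> Y) (l : list X) f :
  Lsum (map h l) f = Lsum l (fun x => f (h x)).
Proof. induction l as [|x l IH]; simpl; [lra|]; rewrite IH; lra. Qed.

Lemma Lsum_flat_map {X Y} (h : X -> list Y) (l : list X) f :
  Lsum (flat_map h l) f = Lsum l (fun x => Lsum (h x) f).
Proof. induction l as [|x l IH]; simpl; [lra|]; rewrite Lsum_app, IH; lra. Qed.

Lemma Lsum_ext {X} (l : list X) f g :
  (forall x, In x l -> f x = g x) -> Lsum l f = Lsum l g.
Proof.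
  induction l as [|x l IH]; simpl; intros E; [reflexivity|].
  rewrite E, IH by auto; reflexivity.
Qed.

Lemma Lsum_le {X} (l : list X) f g :
  (forall x, In x l -> f x <= g x) -> Lsum l f <= Lsum l g.
Proof.
  induction l as [|x l IH]; simpl; intros E; [lra|].
  assert (f x <= g x) by auto; assert (Lsum l f <= Lsum l g) by auto; lra.
Qed.

Lemma Lsum_scal {X} (l : list X) x f : Lsum l (fun y => x * f y) = x * Lsum l f.
Proof. induction l as [|y l IH]; simpl; [lra|]; rewrite IH; lra. Qed.

Lemma Lsum_term_le {X} (l : list X) f x :
  (forall y, In y l -> 0 <= f y) -> In x l -> f x <= Lsum l f.
Proof.
  induction l as [|y l IH]; simpl; intros F Hx; [tauto|].
  assert (0 <= Lsum l f).
  { replace 0 with (Lsum l (fun _ => 0 * 0)); [|rewrite Lsum_scal; ring].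
    apply Lsum_le; intros; rewrite Rmult_0_l; auto. }
  destruct Hx as [->|Hx]; [lra|].
  assert (0 <= f y) by auto; assert (f x <= Lsum l f) by auto; lra.
Qed.

Lemma Lsum_seq m (f : nat -> R) : Lsum (seq 0 m) f = fsum m f.
Proof.
  induction m as [|m IH]; [reflexivity|].
  rewrite seq_S, Lsum_app, IH; simpl; lra.
Qed.

(** * Codebooks *)

(* [(x, q)] in a book is a codeword [x] of length [q] (in nats); Kraft's inequality [kraft l <= 1]
   turns the union bound over the book into a sum of weights [exp (- q)]. *)
Definition kraft {X : Type} (l : list (X * R)) : R := Lsum l (fun xq => exp (- snd xq)).

Definition bind {X Y : Type} (l : list (X * R)) (B : X -> list (Y * R)) : list (Y * R) :=
  flat_map (fun xq => map (fun yq => (fst yq, snd xq + snd yq)) (B (fst xq))) l.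

Lemma kraft_bind {X Y} (l : list (X * R)) (B : X -> list (Y * R)) :
  kraft l <= 1 -> (forall x, kraft (B x) <= 1) -> kraft (bind l B) <= 1.
Proof.
  intros Hl HB; apply Rle_trans with (2 := Hl).
  unfold kraft, bind; rewrite Lsum_flat_map; apply Lsum_le; intros [x q] _; simpl.
  rewrite Lsum_map; simpl.
  rewrite (Lsum_ext _ _ (fun yq => exp (- q) * exp (- snd yq))).
  - rewrite Lsum_scal; specialize (HB x); unfold kraft in HB.
    assert (0 < exp (- q)) by apply exp_pos; nra.
  - intros; rewrite <- exp_plus; f_equal; ring.
Qed.

Lemma in_bind {X Y} (l : list (X * R)) (B : X -> list (Y * R)) x q y q' :
  In (x, q) l -> In (y, q') (B x) -> In (y, q + q') (bind l B).
Proof.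
  intros Hx Hy; unfold bind; apply in_flat_map; exists (x, q); split; [exact Hx|].
  apply in_map_iff; exists (y, q'); auto.
Qed.

Definition recode {X Y : Type} (h : X -> Y) (l : list (X * R)) : list (Y * R) :=
  map (fun xq => (h (fst xq), snd xq)) l.

Lemma kraft_recode {X Y} (h : X -> Y) l : kraft (recode h l) = kraft l.
Proof. unfold kraft, recode; now rewrite Lsum_map. Qed.

Lemma in_recode {X Y} (h : X -> Y) l x q : In (x, q) l -> In (h x, q) (recode h l).
Proof. intros Hx; apply in_map_iff; exists (x, q); auto. Qed.

Fixpoint funs {X : Type} (d : X) (l : list (X * R)) (m : nat) : list ((nat -> X) * R) :=
  match m with
  | O => [(fun _ => d, 0)]
  | S m' => bind (funs d l m')
              (fun f => recode (fun x i => if Nat.eqb i m' then x else f i) l)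
  end.

Lemma kraft_funs {X} (d : X) l m : kraft l <= 1 -> kraft (funs d l m) <= 1.
Proof.
  intros Hl; induction m as [|m IH]; simpl.
  - unfold kraft; simpl; rewrite Ropp_0, exp_0; lra.
  - apply kraft_bind; [exact IH|]; intros; now rewrite kraft_recode.
Qed.

Lemma in_funs {X} (d : X) l m (g : nat -> X) (q : nat -> R) :
  (forall i, (i < m)%nat -> In (g i, q i) l) ->
  exists f, In (f, fsum m q) (funs d l m) /\ forall i, (i < m)%nat -> f i = g i.
Proof.
  induction m as [|m IH]; intros Hg; simpl.
  - exists (fun _ => d); split; [now left|]; intros; lia.
  - destruct IH as (f & Hf & Ef); [auto with arith|].
    exists (fun i => if Nat.eqb i m then g m else f i); split.
    + eapply in_bind; [exact Hf|].
      apply (in_recode (fun x i => if Nat.eqb i m then x else f i)); auto with arith.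
    + intros i Hi; destruct (Nat.eqb_spec i m) as [->|]; [reflexivity|]; apply Ef; lia.
Qed.

Lemma exp_opp_INR_le m : exp (- INR m) <= (1 / 2) ^ m.
Proof.
  induction m as [|m IH].
  - simpl; rewrite Ropp_0, exp_0; lra.
  - rewrite S_INR; replace (- (INR m + 1)) with (- INR m + Ropp 1) by ring.
    rewrite exp_plus; simpl.
    assert (E1 : exp (Ropp 1) <= 1 / 2).
    { rewrite exp_Ropp; assert (2 <= exp 1) by (pose proof (exp_ineq1_le 1); lra).
      replace (1 / 2) with (/ 2) by lra; apply Rinv_le_contravar; lra. }
    assert (0 < exp (Ropp 1)) by apply exp_pos; assert (0 < exp (- INR m)) by apply exp_pos.
    nra.
Qed.

Fixpoint ints (N : nat) : list (R * R) :=
  match N with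
  | O => [(0, 2)]
  | S N' => (INR N, INR N ^ 2 + 2) :: (- INR N, INR N ^ 2 + 2) :: ints N'
  end.

Definition is_int (N : nat) (a : R) : Prop :=
  exists m : nat, (m <= N)%nat /\ (a = INR m \/ a = - INR m).

Lemma kraft_ints N : kraft (ints N) <= 1.
Proof.
  set (e := exp (Ropp 2)).
  assert (E2 : e <= 1 / 4).
  { pose proof (exp_opp_INR_le 2) as E; simpl in E.
    replace (- (1 + 1)) with (Ropp 2) in E by ring; fold e in E; lra. }
  assert (P2 : 0 < e) by apply exp_pos.
  assert (G : kraft (ints N) <= e * (3 - 2 * (1 / 2) ^ N)).
  { induction N as [|N IH].
    - unfold kraft; simpl; fold e; lra.
    - change (kraft (ints (S N))) with
        (exp (- (INR (S N) ^ 2 + 2)) + (exp (- (INR (S N) ^ 2 + 2)) + kraft (ints N))).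
      assert (HE : exp (- (INR (S N) ^ 2 + 2)) <= e * (1 / 2) ^ (S N)).
      { replace (- (INR (S N) ^ 2 + 2)) with (Ropp 2 + - INR (S N) ^ 2) by ring.
        rewrite exp_plus; apply Rmult_le_compat_l; [fold e; lra|].
        apply Rle_trans with (2 := exp_opp_INR_le (S N)).
        assert (1 <= INR (S N)) by (rewrite S_INR; pose proof (pos_INR N); lra).
        destruct (Req_dec (- INR (S N) ^ 2) (- INR (S N))) as [He|Hn]; [rewrite He; lra|].
        left; apply exp_increasing; nra. }
      simpl pow in *; nra. }
  assert (0 < (1 / 2) ^ N) by (apply pow_lt; lra); nra.
Qed.

Lemma in_ints N a : is_int N a -> In (a, a ^ 2 + 2) (ints N).
Proof.
  intros (m & Hm & Ha); induction N as [|N IH].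
  - assert (m = 0)%nat by lia; subst m; left; simpl in Ha.
    assert (a = 0) as -> by (destruct Ha; lra); f_equal; lra.
  - destruct (Nat.eq_dec m (S N)) as [->|Hn].
    + cbn [ints]; destruct Ha as [->| ->]; [now left|]; right; left; f_equal; ring.
    + right; right; apply IH; lia.
Qed.

Definition labels (K : nat) : list (nat * R) := map (fun k => (k, ln (INR K))) (seq 0 K).

Lemma kraft_labels K : kraft (labels K) <= 1.
Proof.
  unfold kraft, labels; rewrite Lsum_map; simpl; rewrite Lsum_seq, fsum_const.
  destruct K as [|K]; [simpl; lra|].
  assert (0 < INR (S K)) by (apply lt_0_INR; lia).
  rewrite exp_Ropp, exp_ln by assumption; rewrite Rinv_r by lra; lra.
Qed.

Lemma in_labels K k : (k < K)%nat -> In (k, ln (INR K)) (labels K).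
Proof. intros Hk; apply in_map_iff; exists k; split; [reflexivity|]; apply in_seq; lia. Qed.

Definition sizes (n : nat) : list (nat * R) := map (fun k => (S k, INR (S k))) (seq 0 n).

Lemma kraft_sizes n : kraft (sizes n) <= 1.
Proof.
  unfold kraft, sizes; rewrite Lsum_map, Lsum_seq; cbn [snd].
  assert (G : fsum n (fun k => exp (- INR (S k))) <= 1 - (1 / 2) ^ n).
  { induction n as [|n IH]; [simpl; lra|]; cbn [fsum].
    pose proof (exp_opp_INR_le (S n)) as HE; simpl pow in *; lra. }
  assert (0 < (1 / 2) ^ n) by (apply pow_lt; lra); lra.
Qed.

Lemma in_sizes n K : (1 <= K)%nat -> (K <= n)%nat -> In (K, INR K) (sizes n).
Proof.
  intros H1 H2; apply in_map_iff; exists (K - 1)%nat.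
  replace (S (K - 1)) with K by lia; split; [reflexivity|]; apply in_seq; lia.
Qed.

(** * Expectations over the random graph *)

Lemma exp_sub_linear (x : R) : exp x <= x + exp (2 * x ^ 2).
Proof.
  assert (E2 : 1 + 2 * x ^ 2 <= exp (2 * x ^ 2)) by apply exp_ineq1_le.
  destruct (Rle_dec x 0) as [Hn|Hp].
  - assert (E1 : 1 + - x <= exp (- x)) by apply exp_ineq1_le.
    assert (M : exp x * exp (- x) = 1) by (rewrite <- exp_plus, Rplus_opp_r; apply exp_0).
    assert (0 < exp x) by apply exp_pos.
    assert (exp x * (1 - x) <= 1) by nra.
    assert (1 <= (1 + x + 2 * x ^ 2) * (1 - x)).
    { replace ((1 + x + 2 * x ^ 2) * (1 - x)) with (1 + x ^ 2 * (1 - 2 * x)) by ring.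
      assert (0 <= x ^ 2) by nra; nra. }
    assert (exp x <= 1 + x + 2 * x ^ 2) by nra; lra.
  - destruct (Rle_dec x 1) as [H1|H1].
    + assert (E1 : 1 + - (x / 2) <= exp (- (x / 2))) by apply exp_ineq1_le.
      set (y := exp (- (x / 2))) in *.
      assert (M : exp x * (y * y) = 1).
      { unfold y; rewrite <- !exp_plus; replace (x + _) with 0 by field; apply exp_0. }
      assert (0 < exp x) by apply exp_pos.
      assert (Q : (1 - x / 2) * (1 - x / 2) <= y * y) by (apply Rmult_le_compat; lra).
      assert (exp x * ((1 - x / 2) * (1 - x / 2)) <= 1) by nra.
      assert (1 <= (1 + x + 2 * x ^ 2) * ((1 - x / 2) * (1 - x / 2))).
      { replace ((1 + x + 2 * x ^ 2) * ((1 - x / 2) * (1 - x / 2)))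
          with (1 + x ^ 2 * ((1 - x) * (5 - 2 * x)) / 4) by field.
        assert (0 <= x ^ 2) by nra; assert (0 <= (1 - x) * (5 - 2 * x)) by nra; nra. }
      assert (0 < (1 - x / 2) * (1 - x / 2)) by nra.
      assert (exp x <= 1 + x + 2 * x ^ 2) by nra; lra.
    + assert (exp x < exp (2 * x ^ 2)) by (apply exp_increasing; nra); lra.
Qed.

Lemma bernoulli_mgf (p s : R) : 0 <= p <= 1 ->
  p * exp (s * (1 - p)) + (1 - p) * exp (s * (0 - p)) <= exp (2 * s ^ 2).
Proof.
  intros Hp.
  assert (M : forall y, -1 <= y <= 1 -> exp (s * y) <= s * y + exp (2 * s ^ 2)).
  { intros y Hy; apply Rle_trans with (1 := exp_sub_linear _).
    apply Rplus_le_compat_l.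
    destruct (Req_dec (2 * (s * y) ^ 2) (2 * s ^ 2)) as [->|Hn]; [lra|].
    left; apply exp_increasing.
    assert (0 <= s ^ 2) by nra; assert (y ^ 2 <= 1) by nra.
    assert ((s * y) ^ 2 <= s ^ 2) by (rewrite Rpow_mult_distr; nra); lra. }
  assert (A := M (1 - p) ltac:(lra)); assert (B := M (0 - p) ltac:(lra)).
  assert (p * exp (s * (1 - p)) <= p * (s * (1 - p) + exp (2 * s ^ 2)))
    by (apply Rmult_le_compat_l; lra).
  assert ((1 - p) * exp (s * (0 - p)) <= (1 - p) * (s * (0 - p) + exp (2 * s ^ 2)))
    by (apply Rmult_le_compat_l; lra).
  lra.
Qed.

Definition symg (a : Graph) : Prop := forall i j, a i j = a j i.

Lemma symg_upd a i j b : symg a -> symg (upd a i j b).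
Proof.
  intros Ha x y; unfold upd; rewrite (Ha x y).
  destruct (Nat.eqb x i), (Nat.eqb y j), (Nat.eqb x j), (Nat.eqb y i); reflexivity.
Qed.

Lemma expect_aux_le p ps a F G :
  (forall ij, In ij ps -> 0 <= p (fst ij) (snd ij) <= 1) -> symg a ->
  (forall b, symg b -> F b <= G b) -> expect_aux p ps a F <= expect_aux p ps a G.
Proof.
  revert a; induction ps as [|[i j] ps IH]; simpl; intros a Hp Ha FG; [auto|].
  assert (P := Hp (i, j) (or_introl eq_refl)); simpl in P.
  apply Rplus_le_compat; apply Rmult_le_compat_l; try lra;
    (apply IH; [auto|now apply symg_upd|assumption]).
Qed.

Lemma expect_aux_ext p ps a F G :
  (forall b, F b = G b) -> expect_aux p ps a F = expect_aux p ps a G.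
Proof.
  revert a; induction ps as [|[i j] ps IH]; simpl; intros a FG; [auto|].
  now rewrite !IH.
Qed.

Lemma expect_aux_plus p ps a F G :
  expect_aux p ps a (fun b => F b + G b) = expect_aux p ps a F + expect_aux p ps a G.
Proof.
  revert a; induction ps as [|[i j] ps IH]; simpl; intros a; [reflexivity|].
  rewrite !IH; ring.
Qed.

Lemma expect_aux_scal p ps a x F :
  expect_aux p ps a (fun b => x * F b) = x * expect_aux p ps a F.
Proof.
  revert a; induction ps as [|[i j] ps IH]; simpl; intros a; [reflexivity|].
  rewrite !IH; ring.
Qed.

Lemma expect_aux_const p ps a x : expect_aux p ps a (fun _ => x) = x.
Proof.
  revert a; induction ps as [|[i j] ps IH]; simpl; intros a; [reflexivity|].
  rewrite !IH; ring.
Qed.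

Lemma expect_aux_Lsum {X} p ps a (l : list X) (F : X -> Graph -> R) :
  expect_aux p ps a (fun b => Lsum l (fun x => F x b)) =
  Lsum l (fun x => expect_aux p ps a (F x)).
Proof.
  induction l as [|x l IH]; simpl; [apply expect_aux_const|].
  rewrite expect_aux_plus, IH; reflexivity.
Qed.

Lemma expect_aux_frozen p ps a i j (phi : bool -> R) G :
  (forall xy, In xy ps -> forall c b, upd c (fst xy) (snd xy) b i j = c i j) ->
  expect_aux p ps a (fun b => phi (b i j) * G b) = phi (a i j) * expect_aux p ps a G.
Proof.
  revert a; induction ps as [|[x y] ps IH]; simpl; intros a Hf; [reflexivity|].
  rewrite !IH by auto.
  rewrite !(Hf (x, y) (or_introl eq_refl)); ring.
Qed.

Lemma upd_same a i j b : upd a i j b i j = b.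
Proof. unfold upd; now rewrite !Nat.eqb_refl. Qed.

Lemma upd_other a x y b i j :
  (x <= y)%nat -> (i <= j)%nat -> (x, y) <> (i, j) -> upd a x y b i j = a i j.
Proof.
  intros Hxy Hij Hn; unfold upd.
  destruct (Nat.eqb_spec i x), (Nat.eqb_spec j y), (Nat.eqb_spec i y), (Nat.eqb_spec j x);
    simpl; try reflexivity; exfalso; apply Hn; f_equal; lia.
Qed.

Lemma expect_aux_exp p (s : nat -> nat -> R) ps a :
  (forall ij, In ij ps -> 0 <= p (fst ij) (snd ij) <= 1) ->
  (forall ij, In ij ps -> (fst ij <= snd ij)%nat) -> NoDup ps ->
  expect_aux p ps a (fun b => exp (Lsum ps (fun ij =>
    s (fst ij) (snd ij) * (adj b (fst ij) (snd ij) - p (fst ij) (snd ij)))))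
  <= exp (Lsum ps (fun ij => 2 * s (fst ij) (snd ij) ^ 2)).
Proof.
  revert a; induction ps as [|[i j] ps IH]; intros a Hp Ho Hd; [simpl; lra|].
  assert (P := Hp (i, j) (or_introl eq_refl)); assert (O := Ho (i, j) (or_introl eq_refl)).
  simpl in P, O; inversion_clear Hd as [|? ? Hi Hd'].
  set (G := fun b : Graph => exp (Lsum ps (fun ij =>
    s (fst ij) (snd ij) * (adj b (fst ij) (snd ij) - p (fst ij) (snd ij))))).
  set (phi := fun b : bool => exp (s i j * ((if b then 1 else 0) - p i j))).
  rewrite (expect_aux_ext p _ a _ (fun b => phi (b i j) * G b)).
  2:{ intros b; unfold phi, G; rewrite <- exp_plus; reflexivity. }
  cbn [expect_aux].
  assert (F : forall xy, In xy ps -> forall c b, upd c (fst xy) (snd xy) b i j = c i j).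
  { intros [x y] Hx c b; apply upd_other; [apply (Ho (x, y)); now right|assumption|].
    intros E; apply Hi; now rewrite <- E. }
  rewrite !expect_aux_frozen, !upd_same by exact F.
  assert (Hps : forall c, expect_aux p ps c G
                 <= exp (Lsum ps (fun ij => 2 * s (fst ij) (snd ij) ^ 2))).
  { intros c; apply IH; [intros; apply Hp; now right|intros; apply Ho; now right|assumption]. }
  change (Lsum ((i, j) :: ps) (fun ij => 2 * s (fst ij) (snd ij) ^ 2))
    with (2 * s i j ^ 2 + Lsum ps (fun ij => 2 * s (fst ij) (snd ij) ^ 2)).
  rewrite exp_plus.
  set (R0 := exp (Lsum ps _)) in *.
  assert (M := bernoulli_mgf (p i j) (s i j) P).
  assert (R0pos : 0 < R0) by apply exp_pos.
  assert (0 < phi true) by apply exp_pos; assert (0 < phi false) by apply exp_pos.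
  apply Rle_trans with ((p i j * phi true + (1 - p i j) * phi false) * R0).
  - rewrite Rmult_plus_distr_r, !Rmult_assoc.
    apply Rplus_le_compat; (apply Rmult_le_compat_l; [lra|]); apply Rmult_le_compat_l; auto; lra.
  - apply Rmult_le_compat_r; [lra|exact M].
Qed.

Lemma in_upper_pairs n i j :
  In (i, j) (upper_pairs n) <-> (i <= j)%nat /\ (j < n)%nat.
Proof.
  unfold upper_pairs; rewrite in_flat_map; split.
  - intros (j' & Hj & Hi); apply in_map_iff in Hi as (i' & E & Hi).
    injection E as -> ->; apply in_seq in Hj, Hi; lia.
  - intros H; exists j; split; [apply in_seq; lia|].
    apply in_map_iff; exists i; split; [reflexivity|apply in_seq; lia].
Qed.

Lemma upper_pairs_S n :
  upper_pairs (S n) = upper_pairs n ++ map (fun i => (i, n)) (seq 0 (S n)).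
Proof.
  unfold upper_pairs at 1; replace (seq 0 (S n)) with (seq 0 n ++ [n]) at 1
    by (symmetry; apply seq_S).
  rewrite flat_map_app; cbn [flat_map]; now rewrite app_nil_r.
Qed.

Lemma NoDup_upper_pairs n : NoDup (upper_pairs n).
Proof.
  induction n as [|n IH]; [constructor|]; rewrite upper_pairs_S.
  apply NoDup_app; [exact IH| |].
  - apply NoDup_map_NoDup_ForallPairs; [|apply seq_NoDup].
    intros x y _ _ E; now injection E.
  - intros [i j] H1 H2; apply in_upper_pairs in H1.
    apply in_map_iff in H2 as (i' & E & _); injection E as -> ->; lia.
Qed.

Lemma Lsum_upper_pairs n (g : nat -> nat -> R) :
  Lsum (upper_pairs n) (fun ij => g (fst ij) (snd ij)) =
  fsum n (fun j => fsum (S j) (fun i => g i j)).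
Proof.
  induction n as [|n IH]; [reflexivity|].
  rewrite upper_pairs_S, Lsum_app, IH, Lsum_map, Lsum_seq; reflexivity.
Qed.

Lemma sum2_upper n (f : nat -> nat -> R) :
  sum2 n n f =
  Lsum (upper_pairs n) (fun ij => if Nat.eqb (fst ij) (snd ij) then f (fst ij) (snd ij)
                                  else f (fst ij) (snd ij) + f (snd ij) (fst ij)).
Proof.
  rewrite (Lsum_upper_pairs n (fun i j => if Nat.eqb i j then f i j else f i j + f j i)).
  assert (E : forall j, fsum (S j) (fun i => if Nat.eqb i j then f i j else f i j + f j i) =
                  fsum j (fun i => f i j) + fsum j (fun i => f j i) + f j j).
  { intros j; cbn [fsum]; rewrite Nat.eqb_refl, <- fsum_plus; f_equal.
    apply fsum_ext; intros i Hi; destruct (Nat.eqb_spec i j); [lia|reflexivity]. }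
  induction n as [|n IH]; [reflexivity|].
  set (h := fun j => fsum (S j) _) in *.
  change (fsum (S n) h) with (fsum n h + h n); rewrite <- IH; pose proof (E n) as En.
  fold (h n) in En; rewrite En.
  unfold sum2; cbn [fsum]; rewrite fsum_plus; ring.
Qed.

Definition ip (n : nat) (M N : nat -> nat -> R) : R := sum2 n n (fun i j => M i j * N i j).
Definition nrm (n : nat) (M : nat -> nat -> R) : R := sum2 n n (fun i j => M i j ^ 2).
Definition noise (T : nat -> nat -> R) (a : Graph) : nat -> nat -> R :=
  fun i j => adj a i j - T i j.

Lemma Expect_le n p F G :
  (forall i j, (i < n)%nat -> (j < n)%nat -> 0 <= p i j <= 1) ->
  (forall b, symg b -> F b <= G b) -> Expect n p F <= Expect n p G.
Proof.
  intros Hp; apply expect_aux_le.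
  - intros [i j] H; apply in_upper_pairs in H; apply Hp; simpl; lia.
  - now intros i j.
Qed.

Lemma Expect_exp_noise n T D :
  (forall i j, (i < n)%nat -> (j < n)%nat -> 0 <= T i j <= 1) ->
  (forall i j, (i < n)%nat -> (j < n)%nat -> T i j = T j i) ->
  Expect n T (fun a => exp (ip n (noise T a) D - 4 * nrm n D)) <= 1.
Proof.
  intros HT Hs.
  set (s := fun i j => if Nat.eqb i j then D i j else D i j + D j i).
  assert (B : Lsum (upper_pairs n) (fun ij => 2 * s (fst ij) (snd ij) ^ 2) <= 4 * nrm n D).
  { unfold nrm; rewrite sum2_upper, <- Lsum_scal; apply Lsum_le; intros [i j] _; simpl.
    unfold s; pose proof (pow2_ge_0 (D i j)); pose proof (pow2_ge_0 (D i j - D j i)).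
    destruct (Nat.eqb i j); lra. }
  apply Rle_trans with (Expect n T (fun a => exp (- (4 * nrm n D)) *
    exp (Lsum (upper_pairs n) (fun ij =>
      s (fst ij) (snd ij) * (adj a (fst ij) (snd ij) - T (fst ij) (snd ij)))))).
  - apply Expect_le; [exact HT|]; intros b Hb; rewrite <- exp_plus; right; f_equal.
    unfold Rminus at 1; rewrite Rplus_comm; f_equal.
    unfold ip; rewrite sum2_upper; apply Lsum_ext; intros [i j] Hij; cbn [fst snd].
    apply in_upper_pairs in Hij; unfold s, noise, adj.
    rewrite (Hb j i), (Hs j i) by lia; destruct (Nat.eqb i j); ring.
  - unfold Expect; rewrite expect_aux_scal.
    apply Rle_trans with (exp (- (4 * nrm n D)) * exp (4 * nrm n D)).
    + apply Rmult_le_compat_l; [left; apply exp_pos|].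
      eapply Rle_trans; [apply expect_aux_exp|].
      * intros [i j] H; apply in_upper_pairs in H; apply HT; simpl; lia.
      * intros [i j] H; apply in_upper_pairs in H; simpl; lia.
      * apply NoDup_upper_pairs.
      * destruct B as [B|B]; [left; now apply exp_increasing|rewrite B; lra].
    + rewrite <- exp_plus, Rplus_opp_l, exp_0; lra.
Qed.

Definition partition_sum (n : nat) (T : nat -> nat -> R)
  (book : list ((nat -> nat -> R) * R)) (a : Graph) : R :=
  1 + Lsum book (fun Dq => exp (ip n (noise T a) (fst Dq) - 4 * nrm n (fst Dq) - snd Dq)).

Lemma partition_sum_ge1 n T book a : 1 <= partition_sum n T book a.
Proof.
  unfold partition_sum.
  assert (0 <= Lsum book (fun Dq => exp (ip n (noise T a) (fst Dq) - 4 * nrm n (fst Dq) - snd Dq))).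
  { induction book as [|x l IH]; simpl; [lra|].
    match goal with |- 0 <= exp ?e + _ => assert (0 < exp e) by apply exp_pos end; lra. }
  lra.
Qed.

Lemma Expect_partition_sum n T book :
  (forall i j, (i < n)%nat -> (j < n)%nat -> 0 <= T i j <= 1) ->
  (forall i j, (i < n)%nat -> (j < n)%nat -> T i j = T j i) ->
  Expect n T (partition_sum n T book) <= 1 + kraft book.
Proof.
  intros HT Hs; unfold Expect, partition_sum.
  rewrite expect_aux_plus, expect_aux_const; apply Rplus_le_compat_l.
  rewrite expect_aux_Lsum; apply Lsum_le; intros [D q] _; simpl.
  rewrite (expect_aux_ext _ _ _ _
    (fun a => exp (- q) * exp (ip n (noise T a) D - 4 * nrm n D))).
  - rewrite expect_aux_scal; rewrite <- (Rmult_1_r (exp (- q))) at 2.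
    apply Rmult_le_compat_l; [left; apply exp_pos|]; now apply Expect_exp_noise.
  - intros a; rewrite <- exp_plus; f_equal; ring.
Qed.

Lemma ip_le_book n T book a D q : In (D, q) book ->
  ip n (noise T a) D <= 4 * nrm n D + q + ln (partition_sum n T book a).
Proof.
  intros H.
  assert (L : exp (ip n (noise T a) D - 4 * nrm n D - q) <= partition_sum n T book a).
  { unfold partition_sum.
    assert (U := Lsum_term_le book
      (fun Dq => exp (ip n (noise T a) (fst Dq) - 4 * nrm n (fst Dq) - snd Dq)) (D, q)
      ltac:(intros; left; apply exp_pos) H); cbn [fst snd] in U; lra. }
  assert (E : ln (exp (ip n (noise T a) D - 4 * nrm n D - q))
              <= ln (partition_sum n T book a)).
  { destruct L as [L|L]; [left; apply ln_increasing; [apply exp_pos|exact L]|rewrite L; lra]. }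
  rewrite ln_exp in E; lra.
Qed.

(** * Noise against blockwise rank-one matrices *)

Lemma round_quadratic (N : nat) (beta gamma x : R) :
  1 <= gamma -> Rabs beta <= INR N ->
  exists a, is_int N a /\
    beta * x - gamma * x ^ 2 - gamma / 4 <= beta * a - gamma * a ^ 2.
Proof.
  intros Hg Hb.
  assert (Hz : exists z : Z,
    beta * x - gamma * x ^ 2 - gamma / 4 <= beta * IZR z - gamma * IZR z ^ 2).
  { destruct (base_Int_part x) as [B1 B2].
    set (z := Int_part x) in *; set (y := IZR z) in *.
    (* a random rounding with mean [x] loses at most its variance times [gamma] *)
    destruct (Rle_dec (beta * x - gamma * x ^ 2 - gamma / 4) (beta * y - gamma * y ^ 2))
      as [Hl|Hn]; [now exists z|].
    exists (z + 1)%Z; rewrite plus_IZR; fold y; apply Rnot_lt_le; intros Hm.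
    set (u := x - y) in *; replace x with (y + u) in * by (unfold u; ring).
    assert (0 <= u < 1) by lra.
    assert (S : (1 - u) * (beta * y - gamma * y ^ 2)
                + u * (beta * (y + 1) - gamma * (y + 1) ^ 2)
                = beta * (y + u) - gamma * (y + u) ^ 2 - gamma * (u * (1 - u))) by ring.
    assert (u * (1 - u) <= 1 / 4) by (pose proof (pow2_ge_0 (u - 1 / 2)); lra).
    assert (gamma * (u * (1 - u)) <= gamma / 4) by nra.
    apply Rnot_le_lt in Hn.
    set (F := beta * (y + u) - gamma * (y + u) ^ 2 - gamma / 4) in *.
    set (f0 := beta * y - gamma * y ^ 2) in *.
    set (f1 := beta * (y + 1) - gamma * (y + 1) ^ 2) in *.
    assert ((1 - u) * (f0 - F) < 0) by nra.
    assert (u * (f1 - F) <= 0) by nra.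
    assert ((1 - u) * (f0 - F) + u * (f1 - F)
      = beta * (y + u) - gamma * (y + u) ^ 2 - gamma * (u * (1 - u)) - F) by lra.
    unfold F in *; lra. }
  destruct Hz as [z Hz].
  destruct (Rle_dec (beta * IZR z - gamma * IZR z ^ 2) 0) as [Hn|Hp].
  - exists 0; split; [exists 0%nat; split; [lia|left; reflexivity]|lra].
  - exists (IZR z); split; [|exact Hz]; apply Rnot_le_lt in Hp.
    assert (HN : Rabs (IZR z) <= INR N).
    { apply Rle_trans with (2 := Hb); apply Rnot_lt_le; intros Hlt.
      assert (P : beta * IZR z <= Rabs beta * Rabs (IZR z)).
      { rewrite <- Rabs_mult; apply Rle_abs. }
      assert (Sq : IZR z ^ 2 = Rabs (IZR z) ^ 2) by (symmetry; apply pow2_abs).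
      pose proof (Rabs_pos beta); nra. }
    exists (Z.abs_nat z).
    assert (EA : INR (Z.abs_nat z) = Rabs (IZR z)).
    { rewrite INR_IZR_INZ, Zabs2Nat.id_abs; apply abs_IZR. }
    split; [apply INR_le; lra|].
    rewrite EA; unfold Rabs; destruct (Rcase_abs (IZR z)); lra.
Qed.

Definition labelled (n K : nat) (r : nat -> nat) : Prop :=
  forall i, (i < n)%nat -> (r i < K)%nat.

Definition energy (n : nat) (x D : nat -> nat -> R) : R :=
  sum2 n n (fun i j => x i j * D i j - 4 * D i j ^ 2).

Lemma energyE n x D : energy n x D = ip n x D - 4 * nrm n D.
Proof.
  unfold energy, ip, nrm.
  rewrite (sum2_ext n n _ (fun i j => x i j * D i j + (-4) * D i j ^ 2))
    by (intros; ring).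
  rewrite sum2_plus, sum2_scal; ring.
Qed.

Lemma round_labelled n K N r (x a : nat -> nat -> R) c (V : nat -> nat -> R) b :
  labelled n K r -> 1 <= c ->
  (forall i j, (i < n)%nat -> (j < n)%nat -> Rabs (x i j * a i j) <= b) ->
  INR n * b <= INR N ->
  exists V',
    (forall j l, (j < n)%nat -> (l < K)%nat -> is_int N (V' j l)) /\
    energy n x (fun i j => a i j * V j (r i)) - c * sum2 n K (fun j l => V j l ^ 2)
      - (c * (INR n * INR K) + 4 * nrm n a) / 4
    <= energy n x (fun i j => a i j * V' j (r i)) - c * sum2 n K (fun j l => V' j l ^ 2).
Proof.
  intros Hr Hc Hb HN.
  set (beta := fun j l => fsum n (fun i => if Nat.eqb (r i) l then x i j * a i j else 0)).
  set (rho := fun j l => fsum n (fun i => if Nat.eqb (r i) l then a i j ^ 2 else 0)).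
  assert (Hrho : forall j l, 0 <= rho j l).
  { intros j l; apply fsum_nonneg; intros i _; destruct (Nat.eqb (r i) l); nra. }
  assert (Sep : forall Y : nat -> nat -> R,
    energy n x (fun i j => a i j * Y j (r i)) - c * sum2 n K (fun j l => Y j l ^ 2)
    = sum2 n K (fun j l => beta j l * Y j l - (c + 4 * rho j l) * Y j l ^ 2)).
  { intros Y; unfold energy.
    rewrite (sum2_if_pick n K r
      (fun i j l => x i j * (a i j * Y j l) - 4 * (a i j * Y j l) ^ 2) Hr).
    rewrite (sum2_ext n K (fun j l => beta j l * Y j l - (c + 4 * rho j l) * Y j l ^ 2)
      (fun j l => (Y j l * beta j l + (- 4 * Y j l ^ 2) * rho j l) + (- c) * Y j l ^ 2))
      by (intros; ring).
    rewrite sum2_plus, sum2_scal; unfold Rminus at 1; f_equal; [|ring].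
    apply sum2_ext; intros j l _ _; unfold beta, rho.
    rewrite <- !fsum_scal, <- fsum_plus; apply fsum_ext; intros i _.
    destruct (Nat.eqb (r i) l); ring. }
  assert (Hnrm : nrm n a = sum2 n K rho).
  { unfold nrm; rewrite (sum2_if_pick n K r (fun i j _ => a i j ^ 2) Hr); reflexivity. }
  assert (R1 : forall jl : nat * nat, exists y, (fst jl < n)%nat ->
    is_int N y /\
    beta (fst jl) (snd jl) * V (fst jl) (snd jl)
      - (c + 4 * rho (fst jl) (snd jl)) * V (fst jl) (snd jl) ^ 2
      - (c + 4 * rho (fst jl) (snd jl)) / 4
    <= beta (fst jl) (snd jl) * y - (c + 4 * rho (fst jl) (snd jl)) * y ^ 2).
  { intros [j l]; cbn [fst snd].
    destruct (lt_dec j n) as [Hj|Hj]; [|exists 0; tauto].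
    destruct (round_quadratic N (beta j l) (c + 4 * rho j l) (V j l)) as [y Hy].
    - specialize (Hrho j l); lra.
    - apply Rle_trans with (2 := HN); apply fsum_abs_le; intros i Hi.
      destruct (Nat.eqb (r i) l); [auto|].
      rewrite Rabs_R0; apply Rle_trans with (2 := Hb i j Hi Hj); apply Rabs_pos.
    - exists y; auto. }
  destruct (functional_choice _ R1) as [h Hh].
  exists (fun j l => h (j, l)); split.
  - intros j l Hj _; exact (proj1 (Hh (j, l) Hj)).
  - pose proof (Sep (fun j l => h (j, l))) as Sh; cbn beta in Sh; rewrite Sh, (Sep V), Hnrm.
    replace (c * (INR n * INR K) + 4 * sum2 n K rho)
      with (sum2 n K (fun j l => c + 4 * rho j l))
      by (rewrite sum2_plus, sum2_const, sum2_scal; ring).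
    set (loss := fun j l => c + 4 * rho j l) in *.
    apply Rle_trans with (sum2 n K (fun j l =>
      (beta j l * V j l - (c + 4 * rho j l) * V j l ^ 2) + - / 4 * loss j l)).
    + rewrite sum2_plus, sum2_scal; change (sum2 n K (fun j l => loss j l)) with (sum2 n K loss); lra.
    + apply sum2_le; intros j l Hj _; pose proof (proj2 (Hh (j, l) Hj)) as G.
      cbn [fst snd] in G; unfold loss; lra.
Qed.

Lemma nk_nonneg n r l : 0 <= nk n r l.
Proof. apply fsum_nonneg; intros i _; destruct (Nat.eqb (r i) l); lra. Qed.

Lemma nk_ge1 n r i : (i < n)%nat -> 1 <= nk n r (r i).
Proof.
  intros Hi; unfold nk.
  apply Rle_trans with (2 := fsum_term_le n (fun i' => if Nat.eqb (r i') (r i) then 1 else 0) i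
    ltac:(intros j _; cbn beta; destruct (Nat.eqb (r j) (r i)); lra) Hi).
  cbn beta; rewrite Nat.eqb_refl; lra.
Qed.

Lemma sum_nk n K r : labelled n K r -> fsum K (nk n r) = INR n.
Proof.
  intros Hr; unfold nk; rewrite <- (fsum_if_pick n K r (fun _ _ => 1) Hr), fsum_const; ring.
Qed.

Lemma inv_sqrt_sq_le1 g : 0 <= g -> (/ sqrt g) ^ 2 * g <= 1.
Proof.
  intros Hg; destruct (Req_dec g 0) as [->|Hn]; [lra|].
  rewrite pow_inv, pow2_sqrt, Rinv_l by lra; lra.
Qed.

Definition rk1 (z r : nat -> nat) (U V : nat -> nat -> R) : nat -> nat -> R :=
  fun i j => U i (z j) * V j (r i).

Definition grid (n : nat) (z r : nat -> nat) (U V : nat -> nat -> R) : nat -> nat -> R :=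
  fun i j => rk1 z r U V i j / sqrt (nk n r (r i)).

Definition bounded_blocks (n K : nat) (r : nat -> nat) (U : nat -> nat -> R) : Prop :=
  forall k l, (k < K)%nat -> (l < K)%nat ->
    fsum n (fun i => if Nat.eqb (r i) l then U i k ^ 2 else 0) <= nk n r l.

Lemma bounded_blocks_entry n K r U i k : labelled n K r -> bounded_blocks n K r U ->
  (i < n)%nat -> (k < K)%nat -> Rabs (U i k * / sqrt (nk n r (r i))) <= 1.
Proof.
  intros Hr HU Hi Hk.
  assert (Hg := nk_ge1 n r i Hi).
  assert (A : U i k ^ 2 <= nk n r (r i)).
  { apply Rle_trans with (2 := HU k (r i) Hk (Hr i Hi)).
    apply Rle_trans with (2 := fsum_term_le n
      (fun i' => if Nat.eqb (r i') (r i) then U i' k ^ 2 else 0) i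
      ltac:(intros j _; cbn beta; destruct (Nat.eqb (r j) (r i)); nra) Hi).
    cbn beta; rewrite Nat.eqb_refl; lra. }
  rewrite <- (Rabs_R1); apply Rsqr_le_abs_0; rewrite !Rsqr_pow2, Rpow_mult_distr.
  assert (B := inv_sqrt_sq_le1 (nk n r (r i)) ltac:(lra)).
  assert (0 <= (/ sqrt (nk n r (r i))) ^ 2) by apply pow2_ge_0.
  nra.
Qed.

Lemma bounded_blocks_total n K r U : labelled n K r -> bounded_blocks n K r U ->
  sum2 n K (fun i k => U i k ^ 2) <= INR n * INR K.
Proof.
  intros Hr HU; rewrite sum2_swap, Rmult_comm, <- fsum_const.
  apply fsum_le; intros k Hk.
  rewrite (fsum_if_pick n K r (fun i _ => U i k ^ 2) Hr), <- (sum_nk n K r Hr).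
  apply fsum_le; auto.
Qed.

Lemma round_grid n K z r (x U V : nat -> nat -> R) :
  labelled n K z -> labelled n K r ->
  (forall i j, (i < n)%nat -> (j < n)%nat -> Rabs (x i j) <= 1) ->
  bounded_blocks n K r U ->
  exists U' V',
    (forall i k, (i < n)%nat -> (k < K)%nat -> is_int (n * n) (U' i k)) /\
    (forall j l, (j < n)%nat -> (l < K)%nat -> is_int (n * n) (V' j l)) /\
    energy n x (grid n z r U V) - 2 * sum2 n K (fun j l => V j l ^ 2)
      - 11 / 4 * (INR n * INR K)
    <= energy n x (grid n z r U' V') - sum2 n K (fun i k => U' i k ^ 2)
       - sum2 n K (fun j l => V' j l ^ 2).
Proof.
  intros Hz Hr Hx HU.
  set (w := fun l => / sqrt (nk n r l)).
  assert (Hw : forall l, w l ^ 2 * nk n r l <= 1)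
    by (intros; apply inv_sqrt_sq_le1, nk_nonneg).
  set (a1 := fun i j => U i (z j) * w (r i)).
  assert (N1 : nrm n a1 <= INR n * INR K).
  { unfold nrm, a1.
    rewrite (sum2_if_pick n K r (fun i j l => (U i (z j) * w l) ^ 2) Hr).
    rewrite <- (Rmult_1_r (INR n * INR K)), <- sum2_const.
    apply sum2_le; intros j l Hj Hl.
    apply Rle_trans with (w l ^ 2 * nk n r l); [|apply Hw].
    apply Rle_trans with (w l ^ 2 *
      fsum n (fun i => if Nat.eqb (r i) l then U i (z j) ^ 2 else 0)).
    - rewrite <- fsum_scal; right; apply fsum_ext; intros i _.
      destruct (Nat.eqb (r i) l); ring.
    - apply Rmult_le_compat_l; [apply pow2_ge_0|]; apply HU; auto. }
  destruct (round_labelled n K n r x a1 2 V 1 Hr) as (V' & IV & EV).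
  { lra. }
  { intros i j Hi Hj; rewrite Rabs_mult.
    assert (Rabs (a1 i j) <= 1) by (apply (bounded_blocks_entry n K); auto).
    pose proof (Rabs_pos (a1 i j)); pose proof (Rabs_pos (x i j)); specialize (Hx i j Hi Hj); nra. }
  { lra. }
  set (a2 := fun j i => V' j (r i) * w (r i)).
  assert (N2 : nrm n a2 <= sum2 n K (fun j l => V' j l ^ 2)).
  { unfold nrm, a2; rewrite sum2_swap.
    rewrite (sum2_if_pick n K r (fun i j l => (V' j l * w l) ^ 2) Hr).
    apply sum2_le; intros j l Hj Hl.
    apply Rle_trans with (V' j l ^ 2 * (w l ^ 2 * nk n r l)).
    - unfold nk; rewrite <- !fsum_scal; right; apply fsum_ext; intros i _.
      destruct (Nat.eqb (r i) l); ring.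
    - specialize (Hw l); pose proof (pow2_ge_0 (V' j l)); nra. }
  destruct (round_labelled n K (n * n) z (fun j i => x i j) a2 1 U (INR n) Hz)
    as (U' & IU & EU).
  { lra. }
  { intros j i Hj Hi; rewrite Rabs_mult; unfold a2; rewrite Rabs_mult.
    destruct (IV j (r i) Hj (Hr i Hi)) as (m & Hm & Ha).
    assert (AV : Rabs (V' j (r i)) <= INR n).
    { apply le_INR in Hm; pose proof (pos_INR m).
      apply Rabs_le; destruct Ha; lra. }
    assert (Aw : Rabs (w (r i)) <= 1).
    { rewrite <- Rabs_R1; apply Rsqr_le_abs_0; rewrite !Rsqr_pow2.
      specialize (Hw (r i)); pose proof (nk_ge1 n r i Hi); pose proof (pow2_ge_0 (w (r i))); nra. }
    pose proof (Rabs_pos (V' j (r i))); pose proof (Rabs_pos (w (r i)));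
      pose proof (Rabs_pos (x i j)); specialize (Hx i j Hi Hj).
    assert (Rabs (V' j (r i)) * Rabs (w (r i)) <= INR n) by nra.
    assert (0 <= Rabs (V' j (r i)) * Rabs (w (r i))) by nra.
    nra. }
  { rewrite mult_INR; lra. }
  exists U', V'; split; [exact IU|]; split.
  { intros j l Hj Hl; destruct (IV j l Hj Hl) as (m & Hm & Ha); exists m; split; [nia|exact Ha]. }
  assert (E1 : forall Y, energy n x (fun i j => a1 i j * Y j (r i)) = energy n x (grid n z r U Y)).
  { intros Y; apply sum2_ext; intros i j _ _; unfold a1, grid, rk1, Rdiv; fold (w (r i)); ring. }
  assert (E2 : forall Y, energy n (fun j i => x i j) (fun j i => a2 j i * Y i (z j))
                         = energy n x (grid n z r Y V')).
  { intros Y; unfold energy; rewrite sum2_swap.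
    apply sum2_ext; intros i j _ _; unfold a2, grid, rk1, Rdiv; fold (w (r i)); ring. }
  rewrite !E1 in EV; rewrite !E2 in EU.
  assert (T := bounded_blocks_total n K r U Hr HU).
  lra.
Qed.

Definition mats (n K : nat) : list ((nat -> nat -> R) * R) :=
  funs (fun _ => 0) (funs 0 (ints (n * n)) K) n.

Lemma kraft_mats n K : kraft (mats n K) <= 1.
Proof. apply kraft_funs, kraft_funs, kraft_ints. Qed.

Lemma in_mats n K (U : nat -> nat -> R) :
  (forall i k, (i < n)%nat -> (k < K)%nat -> is_int (n * n) (U i k)) ->
  exists U', In (U', sum2 n K (fun i k => U i k ^ 2 + 2)) (mats n K) /\
    forall i k, (i < n)%nat -> (k < K)%nat -> U' i k = U i k.
Proof.
  intros HU.
  assert (R1 : forall i, exists f, (i < n)%nat ->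
    In (f, fsum K (fun k => U i k ^ 2 + 2)) (funs 0 (ints (n * n)) K) /\
    forall k, (k < K)%nat -> f k = U i k).
  { intros i; destruct (lt_dec i n) as [Hi|Hi]; [|exists (fun _ => 0); tauto].
    destruct (in_funs 0 (ints (n * n)) K (U i) (fun k => U i k ^ 2 + 2)) as (f & Hf & Ef).
    - intros k Hk; apply in_ints; auto.
    - now exists f. }
  destruct (functional_choice _ R1) as [h Hh].
  destruct (in_funs (fun _ => 0) (funs 0 (ints (n * n)) K) n h
    (fun i => fsum K (fun k => U i k ^ 2 + 2))) as (f & Hf & Ef).
  - intros i Hi; apply (Hh i Hi).
  - exists f; split; [exact Hf|]; intros i k Hi Hk; rewrite Ef by exact Hi.
    apply (Hh i Hi); exact Hk.
Qed.

Definition labellings (n K : nat) : list ((nat -> nat) * R) := funs 0%nat (labels K) n.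

Lemma kraft_labellings n K : kraft (labellings n K) <= 1.
Proof. apply kraft_funs, kraft_labels. Qed.

Lemma in_labellings n K z : labelled n K z ->
  exists z', In (z', INR n * ln (INR K)) (labellings n K) /\
    forall i, (i < n)%nat -> z' i = z i.
Proof.
  intros Hz; destruct (in_funs 0%nat (labels K) n z (fun _ => ln (INR K))) as (f & Hf & Ef).
  - intros i Hi; apply in_labels; auto.
  - rewrite fsum_const in Hf; now exists f.
Qed.

Definition book_rank1 (n : nat) : list ((nat -> nat -> R) * R) :=
  bind (sizes n) (fun K =>
  bind (labellings n K) (fun z =>
  bind (labellings n K) (fun r =>
  bind (mats n K) (fun U => recode (fun V => grid n z r U V) (mats n K))))).

Lemma kraft_book_rank1 n : kraft (book_rank1 n) <= 1.
Proof.
  apply kraft_bind; [apply kraft_sizes|]; intros K.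
  apply kraft_bind; [apply kraft_labellings|]; intros z.
  apply kraft_bind; [apply kraft_labellings|]; intros r.
  apply kraft_bind; [apply kraft_mats|]; intros U.
  rewrite kraft_recode; apply kraft_mats.
Qed.

Lemma nk_ext n r r' l : (forall i, (i < n)%nat -> r i = r' i) -> nk n r l = nk n r' l.
Proof. intros E; apply fsum_ext; intros i Hi; now rewrite E. Qed.

Lemma in_book_rank1 n K z r U V :
  (1 <= K)%nat -> (K <= n)%nat -> labelled n K z -> labelled n K r ->
  (forall i k, (i < n)%nat -> (k < K)%nat -> is_int (n * n) (U i k)) ->
  (forall j l, (j < n)%nat -> (l < K)%nat -> is_int (n * n) (V j l)) ->
  exists D,
    In (D, INR K + (INR n * ln (INR K) + (INR n * ln (INR K) +
        (sum2 n K (fun i k => U i k ^ 2 + 2) + sum2 n K (fun j l => V j l ^ 2 + 2)))))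
       (book_rank1 n) /\
    forall i j, (i < n)%nat -> (j < n)%nat -> D i j = grid n z r U V i j.
Proof.
  intros H1 HK Hz Hr HU HV.
  destruct (in_labellings n K z Hz) as (z' & Iz & Ez).
  destruct (in_labellings n K r Hr) as (r' & Ir & Er).
  destruct (in_mats n K U HU) as (U' & IU & EU).
  destruct (in_mats n K V HV) as (V' & IV & EV).
  exists (grid n z' r' U' V'); split.
  - eapply in_bind; [apply in_sizes; eassumption|].
    eapply in_bind; [exact Iz|]; eapply in_bind; [exact Ir|]; eapply in_bind; [exact IU|].
    now apply (in_recode (fun V => grid n z' r' U' V)).
  - intros i j Hi Hj; unfold grid, rk1.
    rewrite (nk_ext n r' r) by exact Er.
    rewrite (Er i Hi), (Ez j Hj), EU, EV by auto; reflexivity.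
Qed.

Lemma ip_ext n x D D' :
  (forall i j, (i < n)%nat -> (j < n)%nat -> D i j = D' i j) -> ip n x D = ip n x D'.
Proof. intros E; apply sum2_ext; intros; now rewrite E. Qed.

Lemma nrm_ext n D D' :
  (forall i j, (i < n)%nat -> (j < n)%nat -> D i j = D' i j) -> nrm n D = nrm n D'.
Proof. intros E; apply sum2_ext; intros; now rewrite E. Qed.

Lemma noise_bound n T a i j :
  (forall i j, (i < n)%nat -> (j < n)%nat -> 0 <= T i j <= 1) ->
  (i < n)%nat -> (j < n)%nat -> Rabs (noise T a i j) <= 1.
Proof.
  intros HT Hi Hj; specialize (HT i j Hi Hj); unfold noise, adj.
  apply Rabs_le; destruct (a i j); lra.
Qed.

Lemma normalize_blocks n K z r U V :
  labelled n K z -> labelled n K r ->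
  exists U' V', bounded_blocks n K r U' /\
    (forall i j, (i < n)%nat -> (j < n)%nat -> grid n z r U' V' i j = rk1 z r U V i j) /\
    sum2 n K (fun j l => V' j l ^ 2) = nrm n (rk1 z r U V).
Proof.
  intros Hz Hr.
  set (alpha := fun l k => fsum n (fun i => if Nat.eqb (r i) l then U i k ^ 2 else 0)).
  assert (Ha : forall l k, 0 <= alpha l k).
  { intros l k; apply fsum_nonneg; intros i _; destruct (Nat.eqb (r i) l); nra. }
  exists (fun i k => U i k * (sqrt (nk n r (r i)) / sqrt (alpha (r i) k))),
         (fun j l => V j l * sqrt (alpha l (z j))).
  split; [|split].
  - intros k l Hk Hl.
    set (c := sqrt (nk n r l) / sqrt (alpha l k)).
    apply Rle_trans with (c ^ 2 * alpha l k).
    + unfold alpha; rewrite <- fsum_scal; right; apply fsum_ext; intros i _.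
      destruct (Nat.eqb_spec (r i) l) as [->|]; [unfold c, alpha; ring|ring].
    + unfold c, Rdiv; rewrite Rpow_mult_distr, pow2_sqrt by apply nk_nonneg.
      assert (B := inv_sqrt_sq_le1 (alpha l k) (Ha l k)); pose proof (nk_nonneg n r l); nra.
  - intros i j Hi Hj; unfold grid, rk1.
    assert (G := nk_ge1 n r i Hi).
    assert (Gs : 0 < sqrt (nk n r (r i))) by (apply sqrt_lt_R0; lra).
    destruct (Req_dec (alpha (r i) (z j)) 0) as [E0|En].
    + assert (U0 : U i (z j) = 0).
      { assert (L := fsum_term_le n
          (fun i' => if Nat.eqb (r i') (r i) then U i' (z j) ^ 2 else 0) i
          ltac:(intros i' _; cbn beta; destruct (Nat.eqb (r i') (r i)); nra) Hi).
        cbn beta in L; rewrite Nat.eqb_refl in L; fold (alpha (r i) (z j)) in L.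
        rewrite E0 in L; nra. }
      rewrite U0; unfold Rdiv; ring.
    + assert (0 < sqrt (alpha (r i) (z j)))
        by (apply sqrt_lt_R0; specialize (Ha (r i) (z j)); lra).
      field; lra.
  - unfold nrm, rk1.
    rewrite (sum2_if_pick n K r (fun i j l => (U i (z j) * V j l) ^ 2) Hr).
    apply sum2_ext; intros j l _ _.
    rewrite Rpow_mult_distr, pow2_sqrt by apply Ha.
    unfold alpha; rewrite <- fsum_scal; apply fsum_ext; intros i _.
    destruct (Nat.eqb (r i) l); ring.
Qed.

Lemma ln_INR_nonneg K : (1 <= K)%nat -> 0 <= ln (INR K).
Proof.
  intros H; rewrite <- ln_1; destruct (Nat.eq_dec K 1) as [->|Hn]; [simpl; lra|].
  left; apply ln_increasing; [lra|]; apply (lt_INR 1); lia.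
Qed.

Lemma ip_noise_rank1 n T book a K z r U V :
  (forall i j, (i < n)%nat -> (j < n)%nat -> 0 <= T i j <= 1) ->
  incl (book_rank1 n) book ->
  (1 <= K)%nat -> (K <= n)%nat -> labelled n K z -> labelled n K r ->
  ip n (noise T a) (rk1 z r U V) <=
    6 * nrm n (rk1 z r U V) + 8 * INR n * INR K + 2 * INR n * ln (INR K)
    + ln (partition_sum n T book a).
Proof.
  intros HT Hb H1 HK Hz Hr.
  destruct (normalize_blocks n K z r U V Hz Hr) as (U1 & V1 & B1 & E1 & S1).
  destruct (round_grid n K z r (noise T a) U1 V1 Hz Hr) as (U2 & V2 & I2 & J2 & L2).
  { intros; now apply (noise_bound n). }
  { exact B1. }
  destruct (in_book_rank1 n K z r U2 V2 H1 HK Hz Hr I2 J2) as (D & ID & ED).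
  apply Hb in ID; apply (ip_le_book n T book a) in ID.
  rewrite (ip_ext n _ D (grid n z r U2 V2) ED), (nrm_ext n D (grid n z r U2 V2) ED) in ID.
  rewrite !energyE, S1 in L2.
  rewrite (ip_ext n _ _ _ E1), (nrm_ext n _ _ E1) in L2.
  rewrite !sum2_plus, !sum2_const in ID.
  assert (1 <= INR n) by (apply (le_INR 1); lia).
  assert (1 <= INR K) by (apply (le_INR 1); lia).
  assert (INR K <= INR n * INR K) by nra.
  lra.
Qed.

Lemma ip_noise_rank1_scaled n T book a K z r U V :
  (forall i j, (i < n)%nat -> (j < n)%nat -> 0 <= T i j <= 1) ->
  incl (book_rank1 n) book ->
  (1 <= K)%nat -> (K <= n)%nat -> labelled n K z -> labelled n K r ->
  ip n (noise T a) (rk1 z r U V) <=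
    nrm n (rk1 z r U V) / 32 + 192 * (8 * INR n * INR K + 2 * INR n * ln (INR K)
    + ln (partition_sum n T book a)).
Proof.
  intros HT Hb H1 HK Hz Hr.
  assert (L := ip_noise_rank1 n T book a K z r (fun i k => / 192 * U i k) V HT Hb H1 HK Hz Hr).
  assert (E1 : ip n (noise T a) (rk1 z r (fun i k => / 192 * U i k) V) =
               / 192 * ip n (noise T a) (rk1 z r U V)).
  { unfold ip; rewrite <- sum2_scal; apply sum2_ext; intros; unfold rk1; ring. }
  assert (E2 : nrm n (rk1 z r (fun i k => / 192 * U i k) V) =
               (/ 192) ^ 2 * nrm n (rk1 z r U V)).
  { unfold nrm; rewrite <- sum2_scal; apply sum2_ext; intros; unfold rk1; ring. }
  rewrite E1, E2 in L; lra.
Qed.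

Lemma rank1_difference n K z r U V U0 V0 :
  labelled n K r ->
  exists U1 V1 U2 V2,
    (forall i j, (i < n)%nat -> (j < n)%nat ->
       rk1 z r U V i j - rk1 z r U0 V0 i j = rk1 z r U1 V1 i j + rk1 z r U2 V2 i j) /\
    nrm n (fun i j => rk1 z r U V i j - rk1 z r U0 V0 i j)
    = nrm n (rk1 z r U1 V1) + nrm n (rk1 z r U2 V2).
Proof.
  intros Hr.
  (* [t l k] is the coefficient of the projection of [U] on [U0] in block [(l, k)] *)
  set (dot := fun (X Y : nat -> nat -> R) l k =>
    fsum n (fun i => if Nat.eqb (r i) l then X i k * Y i k else 0)).
  set (t := fun l k => dot U U0 l k / dot U0 U0 l k).
  set (U2 := fun i k => U i k - t (r i) k * U0 i k).
  set (V1 := fun j l => t l (z j) * V j l - V0 j l).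
  exists U0, V1, U2, V.
  assert (E : forall i j, rk1 z r U V i j - rk1 z r U0 V0 i j
                          = rk1 z r U0 V1 i j + rk1 z r U2 V i j).
  { intros i j; unfold rk1, U2, V1; ring. }
  split; [intros; apply E|].
  assert (Orth : sum2 n n (fun i j => rk1 z r U0 V1 i j * rk1 z r U2 V i j) = 0).
  { unfold rk1, U2.
    rewrite (sum2_if_pick n K r (fun i j l => U0 i (z j) * V1 j l
      * ((U i (z j) - t l (z j) * U0 i (z j)) * V j l)) Hr).
    apply fsum_zero; intros j _; apply fsum_zero; intros l _.
    set (k := z j).
    assert (P : dot U U0 l k - t l k * dot U0 U0 l k = 0).
    { destruct (Req_dec (dot U0 U0 l k) 0) as [E0|En]; [|unfold t; field; exact En].
      assert (Z : dot U U0 l k = 0).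
      { apply fsum_zero; intros i Hi.
        assert (L := fsum_term_le n (fun i => if Nat.eqb (r i) l then U0 i k * U0 i k else 0) i
          ltac:(intros i' _; cbn beta; destruct (Nat.eqb (r i') l); nra) Hi).
        cbn beta in L; fold (dot U0 U0 l k) in L; rewrite E0 in L.
        destruct (Nat.eqb (r i) l); [|reflexivity].
        assert (U0 i k = 0) as -> by nra; ring. }
      rewrite Z, E0; ring. }
    transitivity ((V1 j l * V j l) * dot U U0 l k + (- (V1 j l * V j l * t l k)) * dot U0 U0 l k);
      [|rewrite <- (Rmult_0_r (V1 j l * V j l)), <- P; ring].
    unfold dot; rewrite <- !fsum_scal, <- fsum_plus; apply fsum_ext; intros i _.
    fold k; destruct (Nat.eqb (r i) l); ring. }
  unfold nrm.
  rewrite (sum2_ext n n _ (fun i j => (rk1 z r U0 V1 i j ^ 2 + rk1 z r U2 V i j ^ 2)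
    + 2 * (rk1 z r U0 V1 i j * rk1 z r U2 V i j))) by (intros; rewrite E; ring).
  rewrite !sum2_plus, sum2_scal, Orth; ring.
Qed.

(** * Best rank-one approximations *)

Lemma cluster_coordinate {I : Type} (S : R -> (I -> R) -> Prop) (b : R) (j : I) :
  (forall e, 0 < e -> exists Y, S e Y) ->
  (forall e e' Y, e <= e' -> S e Y -> S e' Y) ->
  (forall e Y, S e Y -> Rabs (Y j) <= b) ->
  exists x, forall e, 0 < e -> exists Y, S e Y /\ Rabs (Y j - x) < e.
Proof.
  intros HS Hm Hb.
  set (E := fun x => forall e, 0 < e -> exists Y, S e Y /\ x <= Y j).
  destruct (completeness E) as [x [Hub Hlub]].
  - exists b; intros x Hx; destruct (Hx 1 ltac:(lra)) as (Y & SY & HY).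
    apply Hb in SY; pose proof (Rle_abs (Y j)); lra.
  - exists (- b); intros e He; destruct (HS e He) as [Y SY]; exists Y; split; [exact SY|].
    apply Hb in SY; pose proof (Rle_abs (- Y j)); rewrite Rabs_Ropp in *; lra.
  - exists x; intros e He.
    assert (Hup : exists e', 0 < e' /\ forall Y, S e' Y -> Y j < x + e / 2).
    { apply NNPP; intros Hn.
      assert (E (x + e / 2)) as Hx.
      { intros e' He'; apply NNPP; intros Hn'; apply Hn; exists e'; split; [exact He'|].
        intros Y SY; apply Rnot_le_lt; intros Hle; apply Hn'; now exists Y. }
      apply Hub in Hx; lra. }
    destruct Hup as (e' & He' & Hup).
    assert (Hlow : exists y, E y /\ x - e / 2 < y).
    { apply NNPP; intros Hn; assert (x <= x - e / 2); [|lra].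
      apply Hlub; intros y Hy; apply Rnot_lt_le; intros Hlt; apply Hn; now exists y. }
    destruct Hlow as (y & Ey & Hy).
    destruct (Ey (Rmin e e')) as (Y & SY & HY); [now apply Rmin_pos|].
    exists Y; split; [exact (Hm _ _ _ (Rmin_l e e') SY)|].
    assert (U := Hup Y (Hm _ _ _ (Rmin_r e e') SY)); apply Rabs_def1; lra.
Qed.

Lemma cluster_point {I : Type} (dec : forall i j : I, {i = j} + {i <> j}) (js : list I)
  (S : R -> (I -> R) -> Prop) (b : R) :
  (forall e, 0 < e -> exists Y, S e Y) ->
  (forall e e' Y, e <= e' -> S e Y -> S e' Y) ->
  (forall e Y j, In j js -> S e Y -> Rabs (Y j) <= b) ->
  exists l, forall e, 0 < e -> exists Y, S e Y /\ forall j, In j js -> Rabs (Y j - l j) < e.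
Proof.
  revert S; induction js as [|j js IH]; intros S HS Hm Hb.
  - exists (fun _ => 0); intros e He; destruct (HS e He) as [Y SY]; exists Y; split; [exact SY|].
    intros j [].
  - destruct (cluster_coordinate S b j HS Hm) as [x Hx].
    { intros e Y; apply Hb; now left. }
    destruct (IH (fun e Y => S e Y /\ Rabs (Y j - x) < e)) as [l Hl].
    { exact Hx. }
    { intros e e' Y He [SY HY]; split; [now apply (Hm e)|lra]. }
    { intros e Y i Hi [SY _]; apply (Hb e); [now right|exact SY]. }
    exists (fun i => if dec i j then x else l i); intros e He.
    destruct (Hl e He) as (Y & [SY HY] & HYl); exists Y; split; [exact SY|].
    intros i Hi; destruct (dec i j) as [->|Hn]; [exact HY|].
    apply HYl; destruct Hi as [->|Hi]; [now elim Hn|exact Hi].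
Qed.

Lemma Un_cv_const (x : R) : Un_cv (fun _ => x) x.
Proof.
  intros e He; exists 0%nat; intros; unfold Rdist; rewrite Rminus_diag, Rabs_R0; exact He.
Qed.

Lemma Un_cv_fsum m (u : nat -> nat -> R) (l : nat -> R) :
  (forall i, (i < m)%nat -> Un_cv (fun p => u p i) (l i)) ->
  Un_cv (fun p => fsum m (u p)) (fsum m l).
Proof.
  induction m as [|m IH]; intros H; simpl; [apply Un_cv_const|].
  apply CV_plus; auto with arith.
Qed.

Lemma blockdist_nonneg n M X Rs Cs : 0 <= blockdist n M X Rs Cs.
Proof.
  apply fsum_nonneg; intros i _; destruct (Rs i); [|lra].
  apply fsum_nonneg; intros j _; destruct (Cs j); [apply pow2_ge_0|lra].
Qed.

Lemma blockdist_entry n M X Rs Cs i j :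
  (i < n)%nat -> (j < n)%nat -> Rs i = true -> Cs j = true ->
  (M i j - X i j) ^ 2 <= blockdist n M X Rs Cs.
Proof.
  intros Hi Hj Ri Cj; unfold blockdist.
  set (f := fun i => if Rs i then fsum n (fun j => if Cs j then (M i j - X i j) ^ 2 else 0) else 0).
  assert (F : forall i, 0 <= f i).
  { intros i'; unfold f; destruct (Rs i'); [|lra].
    apply fsum_nonneg; intros j' _; destruct (Cs j'); [apply pow2_ge_0|lra]. }
  apply Rle_trans with (2 := fsum_term_le n f i (fun i _ => F i) Hi).
  unfold f; rewrite Ri.
  set (g := fun j => if Cs j then (M i j - X i j) ^ 2 else 0).
  assert (G : forall j, 0 <= g j)
    by (intros j'; unfold g; destruct (Cs j'); [apply pow2_ge_0|lra]).
  apply Rle_trans with (2 := fsum_term_le n g j (fun j _ => G j) Hj).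
  unfold g; rewrite Cj; lra.
Qed.

Lemma rank_le1_minors n Rs Cs X :
  rank_le1_on n Rs Cs X <->
  (forall i i' j j', (i < n)%nat -> (i' < n)%nat -> (j < n)%nat -> (j' < n)%nat ->
     Rs i = true -> Rs i' = true -> Cs j = true -> Cs j' = true ->
     X i j * X i' j' = X i j' * X i' j).
Proof.
  split.
  - intros (u & v & E) i i' j j' Hi Hi' Hj Hj' Ri Ri' Cj Cj'.
    rewrite !E by assumption; ring.
  - intros Hm.
    destruct (classic (exists i j, (i < n)%nat /\ (j < n)%nat /\ Rs i = true /\ Cs j = true
                               /\ X i j <> 0)) as [(i0 & j0 & Hi & Hj & Ri & Cj & Hx)|Hn].
    + exists (fun i => X i j0), (fun j => X i0 j / X i0 j0); intros i j Hi' Hj' Ri' Cj'.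
      apply (Rmult_eq_reg_r (X i0 j0)); [|exact Hx].
      rewrite (Hm i i0 j j0) by assumption; field; exact Hx.
    + exists (fun _ => 0), (fun _ => 0); intros i j Hi Hj Ri Cj; rewrite Rmult_0_l.
      apply NNPP; intros Hx; apply Hn; now exists i, j.
Qed.

Lemma best_rank1_exists n M Rs Cs : exists X, best_rank1 n M Rs Cs X.
Proof.
  set (E := fun y => exists Y, rank_le1_on n Rs Cs Y /\ y = - blockdist n M Y Rs Cs).
  destruct (completeness E) as [m [Hub Hlub]].
  { exists 0; intros y (Y & _ & ->); pose proof (blockdist_nonneg n M Y Rs Cs); lra. }
  { exists (- blockdist n M (fun _ _ => 0) Rs Cs), (fun _ _ => 0); split; [|reflexivity].
    exists (fun _ => 0), (fun _ => 0); intros; ring. }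
  set (b := sum2 n n (fun i j => Rabs (M i j)) + - m + 2).
  set (S := fun e (Y : nat * nat -> R) =>
    let Z := fun i j => Y (i, j) in
    rank_le1_on n Rs Cs Z /\ blockdist n M Z Rs Cs <= - m + e /\
    blockdist n M Z Rs Cs <= - m + 1).
  set (js := filter (fun ij => andb (Rs (fst ij)) (Cs (snd ij)))
               (list_prod (seq 0 n) (seq 0 n))).
  assert (Ijs : forall i j, In (i, j) js <->
    (i < n)%nat /\ (j < n)%nat /\ Rs i = true /\ Cs j = true).
  { intros i j; unfold js; rewrite filter_In, in_prod_iff, !in_seq; cbn [fst snd].
    rewrite Bool.andb_true_iff; intuition lia. }
  assert (dec : forall x y : nat * nat, {x = y} + {x <> y}) by (repeat decide equality).
  destruct (cluster_point dec js S b) as [l Hl].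
  { intros e He.
    assert (Hy : exists Y, rank_le1_on n Rs Cs Y /\ blockdist n M Y Rs Cs <= - m + Rmin e 1).
    { apply NNPP; intros Hn.
      assert (m <= m - Rmin e 1); [|assert (0 < Rmin e 1) by (apply Rmin_pos; lra); lra].
      apply Hlub; intros y (Y & RY & ->); apply Rnot_lt_le; intros Hlt; apply Hn.
      exists Y; split; [exact RY|lra]. }
    destruct Hy as (Y & RY & DY); exists (fun ij => Y (fst ij) (snd ij)).
    pose proof (Rmin_l e 1); pose proof (Rmin_r e 1).
    split; [exact RY|]; split; cbn [fst snd]; (eapply Rle_trans; [exact DY|lra]). }
  { intros e e' Y He (RY & DY & DY1); split; [exact RY|]; split; [lra|exact DY1]. }
  { intros e Y [i j] Hij (_ & _ & DY); apply Ijs in Hij as (Hi & Hj & Ri & Cj).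
    assert (D := blockdist_entry n M (fun i j => Y (i, j)) Rs Cs i j Hi Hj Ri Cj).
    cbn beta in D.
    assert (AM : Rabs (M i j) <= sum2 n n (fun i j => Rabs (M i j))).
    { apply Rle_trans with (fsum n (fun j => Rabs (M i j))).
      - apply (fsum_term_le n (fun j => Rabs (M i j))); [intros; apply Rabs_pos|exact Hj].
      - apply (fsum_term_le n (fun i => fsum n (fun j => Rabs (M i j)))); [|exact Hi].
        intros; apply fsum_nonneg; intros; apply Rabs_pos. }
    assert (AD : Rabs (M i j - Y (i, j)) <= - m + 2).
    { rewrite <- pow2_abs in D; pose proof (Rabs_pos (M i j - Y (i, j))); nra. }
    replace (Y (i, j)) with (M i j + - (M i j - Y (i, j))) by ring.
    apply Rle_trans with (1 := Rabs_triang _ _); rewrite Rabs_Ropp; unfold b; lra. }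
  assert (R1 : forall p : nat, exists Y, S (RinvN p) Y /\
    forall ij, In ij js -> Rabs (Y ij - l ij) < RinvN p)
    by (intros p; apply Hl; apply RinvN_pos).
  destruct (functional_choice _ R1) as [Y HY].
  assert (CY : forall i j, In (i, j) js -> Un_cv (fun p => Y p (i, j)) (l (i, j))).
  { intros i j Hij e He; destruct (RinvN_cv He) as [p0 Hp0]; exists p0; intros p Hp.
    specialize (Hp0 p Hp); unfold Rdist in *; rewrite Rminus_0_r in Hp0.
    destruct (HY p) as [_ HYp]; specialize (HYp (i, j) Hij).
    pose proof (Rle_abs (RinvN p)); lra. }
  exists (fun i j => l (i, j)).
  assert (D : blockdist n M (fun i j => l (i, j)) Rs Cs <= - m).
  { apply (Rle_cv_lim (Un := fun p => blockdist n M (fun i j => Y p (i, j)) Rs Cs)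
             (Vn := fun p => - m + RinvN p)).
    - intros p; apply (proj1 (HY p)).
    - unfold blockdist; apply Un_cv_fsum; intros i Hi.
      destruct (Rs i) eqn:Ri; [|apply Un_cv_const].
      apply Un_cv_fsum; intros j Hj; destruct (Cs j) eqn:Cj; [|apply Un_cv_const].
      assert (C1 : Un_cv (fun p => M i j - Y p (i, j)) (M i j - l (i, j))).
      { apply CV_minus; [apply Un_cv_const|]; apply CY, Ijs; auto. }
      simpl; apply CV_mult; [exact C1|]; apply CV_mult; [exact C1|apply Un_cv_const].
    - replace (- m) with (- m + 0) at 1 by ring; apply CV_plus; [apply Un_cv_const|apply RinvN_cv]. }
  split.
  - apply rank_le1_minors; intros i i' j j' Hi Hi' Hj Hj' Ri Ri' Cj Cj'.
    apply (UL_sequence (fun p => Y p (i, j) * Y p (i', j'))).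
    + apply CV_mult; apply CY, Ijs; auto.
    + apply Un_cv_ext with (fun p => Y p (i, j') * Y p (i', j)).
      * intros p; destruct (HY p) as [[RY _] _].
        symmetry; apply (proj1 (rank_le1_minors n Rs Cs _) RY); assumption.
      * apply CV_mult; apply CY, Ijs; auto.
  - intros Z RZ; apply Rle_trans with (1 := D).
    assert (- blockdist n M Z Rs Cs <= m) by (apply Hub; now exists Z); lra.
Qed.

(** * The oracle inequality *)

Definition Jset (r : nat -> nat) (l : nat) : nat -> bool := fun i => Nat.eqb (r i) l.

Lemma sum_blockdist n K L M r z (X : nat -> nat -> nat -> nat -> R) :
  labelled n L r -> labelled n K z ->
  fsum L (fun l => fsum K (fun k => blockdist n M (X l k) (Jset r l) (Icol z k))) =
  frob2 n M (fun i j => X (r i) (z j) i j).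
Proof.
  intros Hr Hz; unfold frob2.
  rewrite (fsum_if_pick n L r
    (fun i l => fsum n (fun j => (M i j - X l (z j) i j) ^ 2)) Hr).
  apply fsum_ext; intros l _; unfold blockdist; rewrite fsum_swap.
  apply fsum_ext; intros i _; unfold Jset; destruct (Nat.eqb (r i) l).
  - rewrite (fsum_if_pick n K z (fun j k => (M i j - X l k i j) ^ 2) Hz); reflexivity.
  - apply fsum_zero; reflexivity.
Qed.

Lemma blocks_rk1 n K L r z (X : nat -> nat -> nat -> nat -> R) :
  labelled n L r -> labelled n K z ->
  (forall l k, (l < L)%nat -> (k < K)%nat -> rank_le1_on n (Jset r l) (Icol z k) (X l k)) ->
  exists U V, forall i j, (i < n)%nat -> (j < n)%nat ->
    X (r i) (z j) i j = rk1 z r U V i j.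
Proof.
  intros Hr Hz HX.
  assert (R1 : forall lk : nat * nat, exists uv : (nat -> R) * (nat -> R),
    (fst lk < L)%nat -> (snd lk < K)%nat -> forall i j, (i < n)%nat -> (j < n)%nat ->
    Jset r (fst lk) i = true -> Icol z (snd lk) j = true ->
    X (fst lk) (snd lk) i j = fst uv i * snd uv j).
  { intros [l k]; cbn [fst snd].
    destruct (lt_dec l L) as [Hl|Hl]; [|exists (fun _ => 0, fun _ => 0); tauto].
    destruct (lt_dec k K) as [Hk|Hk]; [|exists (fun _ => 0, fun _ => 0); tauto].
    destruct (HX l k Hl Hk) as (u & v & E); exists (u, v); auto. }
  destruct (functional_choice _ R1) as [h Hh].
  exists (fun i k => fst (h (r i, k)) i), (fun j l => snd (h (l, z j)) j).
  intros i j Hi Hj; unfold rk1.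
  apply (Hh (r i, z j)); cbn [fst snd]; auto; apply Nat.eqb_refl.
Qed.

Lemma blocks_best_exist n M r z :
  exists X : nat -> nat -> nat -> nat -> R,
    forall l k, best_rank1 n M (Jset r l) (Icol z k) (X l k).
Proof.
  destruct (functional_choice
    (fun lk X => best_rank1 n M (Jset r (fst lk)) (Icol z (snd lk)) X)
    (fun lk => best_rank1_exists n M _ _)) as [h Hh].
  exists (fun l k => h (l, k)); intros l k; exact (Hh (l, k)).
Qed.

Lemma rank_le1_rk1 n r z U V l k : rank_le1_on n (Jset r l) (Icol z k) (rk1 z r U V).
Proof.
  exists (fun i => U i k), (fun j => V j l); intros i j _ _ Hi Hj.
  unfold Jset, Icol in *; apply Nat.eqb_eq in Hi, Hj; unfold rk1; now subst.
Qed.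

Lemma projection_exists n K L M r z :
  labelled n L r -> labelled n K z ->
  exists U0 V0, forall U V, frob2 n M (rk1 z r U0 V0) <= frob2 n M (rk1 z r U V).
Proof.
  intros Hr Hz; destruct (blocks_best_exist n M r z) as [X HX].
  destruct (blocks_rk1 n K L r z X Hr Hz) as (U0 & V0 & E).
  { intros l k _ _; apply HX. }
  exists U0, V0; intros U V.
  apply Rle_trans with (frob2 n M (fun i j => X (r i) (z j) i j)).
  - right; apply sum2_ext; intros i j Hi Hj; now rewrite E.
  - rewrite <- (sum_blockdist n K L M r z X Hr Hz).
    rewrite <- (sum_blockdist n K L M r z (fun _ _ => rk1 z r U V) Hr Hz
      : _ = frob2 n M (rk1 z r U V)).
    apply sum2_le; intros l k _ _; apply HX, rank_le1_rk1.
Qed.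

Lemma rk1_ext n z z' r r' U V i j :
  (forall i, (i < n)%nat -> z' i = z i) -> (forall i, (i < n)%nat -> r' i = r i) ->
  (i < n)%nat -> (j < n)%nat -> rk1 z' r' U V i j = rk1 z r U V i j.
Proof. intros Ez Er Hi Hj; unfold rk1; now rewrite Ez, Er. Qed.

Lemma frob2_ext n M N N' :
  (forall i j, (i < n)%nat -> (j < n)%nat -> N i j = N' i j) -> frob2 n M N = frob2 n M N'.
Proof. intros E; apply sum2_ext; intros; now rewrite E. Qed.

Lemma book_projections n T : exists book,
  kraft book <= 1 /\
  forall K z r, (1 <= K)%nat -> (K <= n)%nat -> labelled n K z -> labelled n K r ->
  exists U0 V0 D,
    In (D, INR K + (INR n * ln (INR K) + INR n * ln (INR K))) book /\
    (forall i j, (i < n)%nat -> (j < n)%nat -> D i j = / 64 * (rk1 z r U0 V0 i j - T i j)) /\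
    forall U V, frob2 n T (rk1 z r U0 V0) <= frob2 n T (rk1 z r U V).
Proof.
  assert (R1 : forall Kzr : nat * ((nat -> nat) * (nat -> nat)), exists UV :
    (nat -> nat -> R) * (nat -> nat -> R), let '(K, (z, r)) := Kzr in
    labelled n K z -> labelled n K r ->
    forall U V, frob2 n T (rk1 z r (fst UV) (snd UV)) <= frob2 n T (rk1 z r U V)).
  { intros (K & z & r).
    destruct (classic (labelled n K z)) as [Hz|Hz];
      [|exists (fun _ _ => 0, fun _ _ => 0); tauto].
    destruct (classic (labelled n K r)) as [Hr|Hr];
      [|exists (fun _ _ => 0, fun _ _ => 0); tauto].
    destruct (projection_exists n K K T r z Hr Hz) as (U0 & V0 & H); now exists (U0, V0). }
  destruct (functional_choice _ R1) as [h Hh].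
  exists (bind (sizes n) (fun K => bind (labellings n K) (fun z =>
    recode (fun r i j => / 64 * (rk1 z r (fst (h (K, (z, r)))) (snd (h (K, (z, r)))) i j - T i j))
      (labellings n K)))).
  split.
  - apply kraft_bind; [apply kraft_sizes|]; intros K.
    apply kraft_bind; [apply kraft_labellings|]; intros z.
    rewrite kraft_recode; apply kraft_labellings.
  - intros K z r H1 HK Hz Hr.
    destruct (in_labellings n K z Hz) as (z' & Iz & Ez).
    destruct (in_labellings n K r Hr) as (r' & Ir & Er).
    set (UV := h (K, (z', r'))).
    exists (fst UV), (snd UV),
      (fun i j => / 64 * (rk1 z' r' (fst UV) (snd UV) i j - T i j)); split; [|split].
    + eapply in_bind; [now apply in_sizes|]; eapply in_bind; [exact Iz|].
      apply (in_recode (fun r i j => / 64 * (rk1 z' r (fst (h (K, (z', r))))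
        (snd (h (K, (z', r)))) i j - T i j)) (labellings n K) r' _ Ir).
    + intros i j Hi Hj; now rewrite (rk1_ext n z z' r r').
    + intros U V.
      assert (L := Hh (K, (z', r'))); cbn beta iota in L.
      specialize (L ltac:(intros i Hi; rewrite Ez; auto) ltac:(intros i Hi; rewrite Er; auto) U V).
      fold UV in L.
      assert (F : forall X Y, frob2 n T (rk1 z r X Y) = frob2 n T (rk1 z' r' X Y)).
      { intros X Y; apply frob2_ext; intros; symmetry; now apply (rk1_ext n). }
      rewrite !F; exact L.
Qed.

Lemma frob2_nonneg n M N : 0 <= frob2 n M N.
Proof. apply sum2_nonneg; intros; apply pow2_ge_0. Qed.

Lemma nrm_sub_le n M N T :
  nrm n (fun i j => M i j - N i j) <= 2 * frob2 n M T + 2 * frob2 n N T.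
Proof.
  unfold nrm, frob2; fold (sum2 n n (fun i j => (M i j - T i j) ^ 2));
    fold (sum2 n n (fun i j => (N i j - T i j) ^ 2)).
  rewrite <- !sum2_scal, <- sum2_plus; apply sum2_le; intros i j _ _.
  pose proof (pow2_ge_0 (M i j - T i j + (N i j - T i j))); lra.
Qed.

Lemma frob2_sym n M N : frob2 n M N = frob2 n N M.
Proof. apply sum2_ext; intros; ring. Qed.

Lemma oracle_inequality n T book :
  (forall i j, (i < n)%nat -> (j < n)%nat -> 0 <= T i j <= 1) ->
  incl (book_rank1 n) book ->
  (forall K z r, (1 <= K)%nat -> (K <= n)%nat -> labelled n K z -> labelled n K r ->
   exists U0 V0 D,
    In (D, INR K + (INR n * ln (INR K) + INR n * ln (INR K))) book /\
    (forall i j, (i < n)%nat -> (j < n)%nat -> D i j = / 64 * (rk1 z r U0 V0 i j - T i j)) /\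
    forall U V, frob2 n T (rk1 z r U0 V0) <= frob2 n T (rk1 z r U V)) ->
  forall a K z r U V s,
    (1 <= K)%nat -> (K <= n)%nat -> labelled n K z -> labelled n K r ->
    frob2 n (adj a) (rk1 z r U V) <= frob2 n (adj a) T + s ->
    5 / 8 * frob2 n (rk1 z r U V) T <=
      s + 896 * (8 * INR n * INR K + 2 * INR n * ln (INR K) + ln (partition_sum n T book a)).
Proof.
  intros HT Hb1 Hb2 a K z r U V s H1 HK Hz Hr Hmin.
  destruct (Hb2 K z r H1 HK Hz Hr) as (U0 & V0 & D & ID & ED & Hopt).
  specialize (Hopt U V).
  destruct (rank1_difference n K z r U V U0 V0 Hr) as (U1 & V1 & U2 & V2 & E12 & N12).
  assert (L1 := ip_noise_rank1_scaled n T book a K z r U1 V1 HT Hb1 H1 HK Hz Hr).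
  assert (L2 := ip_noise_rank1_scaled n T book a K z r U2 V2 HT Hb1 H1 HK Hz Hr).
  assert (L0 := ip_le_book n T book a _ _ ID).
  set (x := noise T a) in *; set (W := ln (partition_sum n T book a)) in *.
  set (Q := rk1 z r U V) in *; set (P := rk1 z r U0 V0) in *.
  assert (B1 : frob2 n (adj a) Q = frob2 n (adj a) T - 2 * ip n x (fun i j => Q i j - T i j)
                                   + frob2 n Q T).
  { unfold frob2, ip; change (sum2 n n (fun i j => (adj a i j - Q i j) ^ 2) =
      sum2 n n (fun i j => (adj a i j - T i j) ^ 2)
      - 2 * sum2 n n (fun i j => x i j * (Q i j - T i j))
      + sum2 n n (fun i j => (Q i j - T i j) ^ 2)).
    rewrite (sum2_ext n n (fun i j => (adj a i j - Q i j) ^ 2)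
      (fun i j => ((adj a i j - T i j) ^ 2 + - 2 * (x i j * (Q i j - T i j)))
                   + (Q i j - T i j) ^ 2)) by (intros; unfold x, noise; ring).
    rewrite !sum2_plus, sum2_scal; ring. }
  assert (B2 : ip n x (fun i j => Q i j - T i j) =
    ip n x (rk1 z r U1 V1) + ip n x (rk1 z r U2 V2) + 64 * ip n x D).
  { unfold ip; rewrite <- sum2_scal, <- !sum2_plus; apply sum2_ext; intros i j Hi Hj.
    rewrite ED by assumption; fold P.
    specialize (E12 i j Hi Hj).
    replace (Q i j - T i j) with ((Q i j - P i j) + (P i j - T i j)) by ring.
    rewrite E12; field. }
  assert (B3 : nrm n D = (/ 64) ^ 2 * frob2 n P T).
  { unfold nrm, frob2; fold (sum2 n n (fun i j => (P i j - T i j) ^ 2)).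
    rewrite <- sum2_scal; apply sum2_ext; intros; rewrite ED by assumption; fold P; ring. }
  assert (B4 := nrm_sub_le n Q P T).
  rewrite (frob2_sym n T P), (frob2_sym n T Q) in Hopt.
  assert (1 <= INR n) by (apply (le_INR 1); lia).
  assert (1 <= INR K) by (apply (le_INR 1); lia).
  assert (INR K <= INR n * INR K) by nra.
  assert (0 <= frob2 n P T) by apply frob2_nonneg.
  rewrite B3 in L0.
  assert (H64 : 2 * (64 * ip n x D) <= frob2 n P T / 8
     + 128 * (8 * INR n * INR K + 2 * INR n * ln (INR K) + W)) by lra.
  lra.
Qed.

Lemma estimate_blocks n pen M Phat T Ks Ls zs cs B H :
  NBM_rep n Ks Ls T zs cs B H -> is_estimate n pen M Phat ->
  exists K L z r U V,
    (1 <= K)%nat /\ (K <= n)%nat /\ labelled n K z /\ labelled n K r /\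
    (forall i j, (i < n)%nat -> (j < n)%nat -> Phat i j = rk1 z r U V i j) /\
    frob2 n M (rk1 z r U V) + pen K L <= frob2 n M T + pen Ks Ls.
Proof.
  intros (HL & HLK & HKn & HT & Hz & Hc & _ & _ & _ & HP)
    (K & L & z & c & X & (HL' & HLK' & HKn' & Hz' & Hc') & HX & EX & Hmin).
  set (r := fun i => c (z i)); set (rs := fun i => cs (zs i)).
  assert (Hr : labelled n L r) by (intros i Hi; apply Hc', Hz', Hi).
  assert (Hrs : labelled n Ls rs) by (intros i Hi; apply Hc, Hz, Hi).
  destruct (blocks_rk1 n K L r z X Hr Hz') as (U & V & E).
  { intros l k Hl Hk; apply (HX l k Hl Hk). }
  exists K, L, z, r, U, V.
  split; [lia|]; split; [exact HKn'|]; split; [exact Hz'|]; split.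
  { intros i Hi; specialize (Hr i Hi); lia. }
  split.
  { intros i j Hi Hj; rewrite EX by assumption; now apply E. }
  destruct (blocks_best_exist n M rs zs) as [X' HX'].
  assert (G := Hmin Ks Ls zs cs X' (conj HL (conj HLK (conj HKn (conj Hz Hc))))
                 (fun l k _ _ => HX' l k)).
  unfold crit in G.
  change (fsum L (fun l => fsum K (fun k => blockdist n M (X l k) (Jset r l) (Icol z k)))
    + pen K L <= fsum Ls (fun l => fsum Ks (fun k =>
      blockdist n M (X' l k) (Jset rs l) (Icol zs k))) + pen Ks Ls) in G.
  rewrite (sum_blockdist n K L M r z X Hr Hz') in G.
  rewrite (frob2_ext n M _ (rk1 z r U V) E) in G.
  apply Rle_trans with (1 := G); apply Rplus_le_compat_r.
  rewrite <- (sum_blockdist n Ks Ls M rs zs (fun _ _ => T) Hrs Hz : _ = frob2 n M T).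
  apply sum2_le; intros l k _ _; apply HX'.
  exists (fun i => B (zs i) k * H i (cs k)), (fun j => H j l).
  intros i j Hi Hj Ri Cj; unfold Jset, Icol, rs in *.
  apply Nat.eqb_eq in Ri, Cj; subst; now apply HP.
Qed.

Theorem theorem2 :
  exists Psi1 Psi2 Psi3 Ct : R,
    0 < Psi1 /\ 0 < Psi2 /\ 0 < Psi3 /\ 0 < Ct /\
    forall (n Ks Ls : nat) (Ps : nat -> nat -> R)
           (zs cs : nat -> nat) (B H : nat -> nat -> R) (lam0 : R),
      (2 <= n)%nat ->
      (forall i j, (i < n)%nat -> (j < n)%nat -> Ps i j = Ps j i) ->
      NBM_rep n Ks Ls Ps zs cs B H ->
      AssumptionA1 Ks B lam0 ->
      AssumptionA2 n Ks Ls zs H ->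
      forall Phat : Graph -> nat -> nat -> R,
        (forall a : Graph, is_estimate n (Pen Psi1 Psi2 Psi3 n) (adj a) (Phat a)) ->
        (forall t : R, 0 < t ->
           Prob_le n Ps (fun a => frob2 n (Phat a) Ps)
                   (Ct * (Pen Psi1 Psi2 Psi3 n Ks Ls + t))
           >= 1 - 3 * exp (- t)) /\
        Expect n Ps (fun a => frob2 n (Phat a) Ps)
          <= Ct * (Pen Psi1 Psi2 Psi3 n Ks Ls + 3).
Proof.
  exists 7168, 1, 1792, 1500.
  do 4 (split; [lra|]).
  intros n Ks Ls Ps zs cs B H lam0 Hn Hsym Hrep _ _ Phat Hest.
  assert (HP : forall i j, (i < n)%nat -> (j < n)%nat -> 0 <= Ps i j <= 1) by apply Hrep.
  destruct (book_projections n Ps) as (book2 & K2 & Hbook2).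
  set (book := book_rank1 n ++ book2).
  set (W := partition_sum n Ps book).
  assert (EW : Expect n Ps W <= 3).
  { apply Rle_trans with (1 := Expect_partition_sum n Ps book HP Hsym).
    unfold book, kraft; rewrite Lsum_app.
    pose proof (kraft_book_rank1 n) as K1; unfold kraft in K1, K2; lra. }
  assert (W1 : forall a, 1 <= W a) by (intros; apply partition_sum_ge1).
  assert (LW : forall a, 0 <= ln (W a)).
  { intros a; rewrite <- ln_1; specialize (W1 a).
    destruct W1 as [W1|W1]; [left; apply ln_increasing; lra|rewrite <- W1; lra]. }
  set (pen := Pen 7168 1 1792 n) in *.
  assert (Pn : 0 <= ln (INR n)) by (apply ln_INR_nonneg; lia).
  assert (Hpen : 0 <= pen Ks Ls).
  { destruct Hrep as (A1 & A2 & A3 & _); unfold pen, Pen.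
    assert (0 <= ln (INR Ks)) by (apply ln_INR_nonneg; lia).
    pose proof (pos_INR n); pose proof (pos_INR Ks); pose proof (pow2_ge_0 (INR Ks)).
    assert (0 <= INR n * INR Ks) by nra; assert (0 <= INR Ks ^ 2 * ln (INR n)) by nra.
    assert (0 <= INR n * ln (INR Ks)) by nra; lra. }
  assert (Main : forall a, frob2 n (Phat a) Ps <= 1500 * (pen Ks Ls + ln (W a))).
  { intros a.
    destruct (estimate_blocks n pen (adj a) (Phat a) Ps Ks Ls zs cs B H Hrep (Hest a))
      as (K & L & z & r & U & V & H1 & HK & Hz & Hr & E & Hmin).
    assert (O := oracle_inequality n Ps book HP).
    specialize (O ltac:(apply incl_appl, incl_refl)).
    specialize (O ltac:(intros K' z' r' A1 A2 A3 A4;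
      destruct (Hbook2 K' z' r' A1 A2 A3 A4) as (U0 & V0 & D & ID & R0);
      exists U0, V0, D; split; [apply in_or_app; now right|exact R0])).
    specialize (O a K z r U V (pen Ks Ls - pen K L) H1 HK Hz Hr ltac:(lra)).
    rewrite (frob2_sym n (Phat a)), (frob2_ext n Ps _ _ E), frob2_sym.
    fold (W a) in O.
    assert (HpenK : 896 * (8 * INR n * INR K + 2 * INR n * ln (INR K)) <= pen K L).
    { unfold pen, Pen; pose proof (pow2_ge_0 (INR K)).
      assert (0 <= INR K ^ 2 * ln (INR n)) by nra; lra. }
    specialize (LW a); lra. }
  split.
  - intros t Ht; unfold Prob_le; apply Rle_ge.
    apply Rle_trans with (Expect n Ps (fun a => 1 + - exp (- t) * W a)).
    + unfold Expect in *; rewrite expect_aux_plus, expect_aux_const, expect_aux_scal.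
      assert (0 < exp (- t)) by apply exp_pos.
      change (fun b => W b) with W; nra.
    + apply Expect_le; [exact HP|]; intros a _.
      assert (0 < exp (- t)) by apply exp_pos; specialize (W1 a).
      destruct (Rle_dec (frob2 n (Phat a) Ps) (1500 * (pen Ks Ls + t))) as [Hle|Hgt]; [nra|].
      assert (Hlt : t < ln (W a)).
      { specialize (Main a); lra. }
      apply exp_increasing in Hlt; rewrite exp_ln in Hlt by lra.
      assert (exp (- t) * exp t = 1) by (rewrite <- exp_plus, Rplus_opp_l; apply exp_0).
      nra.
  - apply Rle_trans with (Expect n Ps (fun a => 1500 * pen Ks Ls + 1500 * W a)).
    + apply Expect_le; [exact HP|]; intros a _; specialize (Main a); specialize (W1 a).
      assert (ln (W a) <= W a).
      { pose proof (exp_ineq1_le (ln (W a))) as G; rewrite exp_ln in G by lra; lra. }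
      lra.
    + unfold Expect in *; rewrite expect_aux_plus, expect_aux_const, expect_aux_scal.
      change (fun b => W b) with W; lra.
Qed.
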